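(* Let $\Phi$ be an Orlicz function satisfying the $\Delta_2$-condition. There is a constant $C_\Phi>0$ depending only on $\Phi$ such that for every $n\in\mathbb{N}$ and every sequence $\{f_k\}_{k=1}^n\subset L_\Phi[0,1]$ of independent random variables, with $f=\bigoplus_{k=1}^n f_k$, the following hold. (i) If $f_k$, $1\le k\le n$, are positive, then $$\mathbb{E}\Big(\Phi\big(\sum_{k=1}^n f_k\big)\Big)\approx_{C_\Phi}\mathbb{E}\Big(\Phi\big(\mu(f)\chi_{(0,1)}\big)\Big)+\Phi\big(\|f\|_1\big).$$ (ii) If $f_k$, $1\le k\le n$, are symmetrically distributed, then $$\mathbb{E}\Big(\Phi\big(\sum_{k=1}^n f_k\big)\Big)\approx_{C_\Phi}\mathbb{E}\Big(\Phi\big(\mu(f)\chi_{(0,1)}\big)\Big)+\Phi\big(\|f\|_{L_1+L_2}\big).$$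
   Context: $X\approx_C Y$ means $X\le CY$ and $Y\le CX$. Random variables are a.e. finite real-valued Lebesgue measurable functions on $(0,1)$ with Lebesgue measure $\mathbb P$; $\mathbb E(g)=\int_0^1 g(t)\,dt$ ; ''positive'' means $\ge 0$; $f_k$ is symmetrically distributed if $f_k$ and $-f_k$ have the same distribution. An Orlicz function is an even convex function $\Phi:\mathbb R\to[0,\infty)$ with $\Phi(0)=0$; it satisfies the $\Delta_2$-condition if there is $C$ with $\Phi(2t)\le C\Phi(t)$ for all $t>0$. $L_\Phi[0,1]$ is the set of measurable $g$ on $[0,1]$ with $\|g\|_{L_\Phi}=\inf\{\lambda>0:\int_0^1\Phi(g(t)/\lambda)\,dt\le1\}<\infty$. The disjoint sum $\bigoplus_{k=1}^n f_k$ is the function on $(0,\infty)$ equal to $f_k(t-k+1)$ for $t\in(k-1,k)$, $1\le k\le n$, and $0$ for $t\geq n$. For measurable $g$ on $(0,\infty)$, $\mu(g)$ is the decreasing rearrangement of $|g|$: $\mu(t,g)=\inf\{u\ge0:\mathrm{Leb}\{|g|>u\}\le t\}$, $t>0$; thus $\mathbb E(\Phi(\mu(f)\chi_{(0,1)}))=\int_0^1\Phi(\mu(t,f))\,dt$. $\|f\|_1$ is the $L_1(0,\infty)$-norm, and $\|f\|_{L_1+L_2}=\inf\{\|g\|_{L_1}+\|h\|_{L_2}: f=g+h,\ g\in L_1(0,\infty),\ h\in L_2(0,\infty)\}$. *)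

(* Defs.v *)
From HB Require Import structures.
From mathcomp Require Import all_boot all_order all_algebra.
From mathcomp Require Import all_classical all_reals all_analysis.

Set Implicit Arguments.
Unset Strict Implicit.
Unset Printing Implicit Defensive.

Import Order.TTheory GRing.Theory Num.Theory.
Import numFieldNormedType.Exports.

Local Open Scope classical_set_scope.
Local Open Scope ring_scope.

Section Lebesgue_spaces.
Variable R : realType.

(* The real line with the sigma-algebra of all Lebesgue measurable sets
   ([measurableTypeR R] only carries the Borel sets). *)
Definition lebesgueType := caratheodory_type ((wlength (@idfun R))^*)%mu.

Definition leb : {measure set lebesgueType -> \bar R} :=
  @completed_lebesgue_measure R.

Lemma lebesgue_measurable_itv (i : interval R) :
  measurable ([set` i] : set lebesgueType).
Proof.
by apply: sub_caratheodory; exact: (measurable_itv i).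
Qed.

(* Lebesgue measure on (0,1) and on (0,oo), as measures on the whole line
   concentrated on these intervals; what a function does off the interval is
   irrelevant. *)
Definition unit_prob : set lebesgueType -> \bar R :=
  mrestr leb (lebesgue_measurable_itv `]0, 1[).

HB.instance Definition _ := Measure.on unit_prob.

Lemma unit_prob_setT : unit_prob [set: lebesgueType] = 1%E.
Proof.
rewrite /unit_prob/= /mrestr setTI.
transitivity (@lebesgue_measure R `]0, 1[%classic) => //.
by rewrite lebesgue_measure_itv/= lte_fin ltr01 sube0.
Qed.

HB.instance Definition _ :=
  Measure_isProbability.Build _ _ _ unit_prob unit_prob_setT.

Definition half_line : {measure set lebesgueType -> \bar R} :=
  mrestr leb (lebesgue_measurable_itv `]0, +oo[).

End Lebesgue_spaces.

Arguments leb {R}.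
Arguments unit_prob {R}.
Arguments half_line {R}.

Section random_variables.
Context d (T : measurableType d) (R : realType) (P : probability T R).

Definition independent_RVs n (X : 'I_n -> {RV P >-> measurableTypeR R}) :=
  forall (J : {set 'I_n}) (B : 'I_n -> set (measurableTypeR R)),
    (forall k, measurable (B k)) ->
    P (\bigcap_(k in [set k | k \in J]) (X k @^-1` B k)) =
    (\prod_(k in J) P (X k @^-1` B k))%E.

Definition symmetric_RV (X : {RV P >-> measurableTypeR R}) :=
  forall B : set (measurableTypeR R), measurable B ->
    P (X @^-1` B) = P ((fun t => - X t) @^-1` B).

End random_variables.

Section Orlicz.
Variable R : realType.
Implicit Types Phi : R -> R.

Definition Orlicz_function Phi :=
  [/\ forall t, Phi (- t) = Phi t,
      convex_function (E := R^o) setT Phi,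
      forall t, 0 <= Phi t
    & Phi 0 = 0].

Definition Delta2 Phi :=
  exists C : R, forall t, 0 < t -> Phi (2 * t) <= C * Phi t.

Local Open Scope ereal_scope.

Definition Luxemburg_norm Phi (g : R -> R) : \bar R :=
  ereal_inf [set l%:E | l in [set l : R | (0 < l)%R /\
    \int[leb]_(t in `[0%R, 1%R]) (Phi (g t / l)%R)%:E <= 1]].

Definition Orlicz_space Phi : set (R -> R) :=
  [set g | measurable_fun (`[0%R, 1%R] : set (lebesgueType R))
             (g : lebesgueType R -> measurableTypeR R)
         /\ Luxemburg_norm Phi g < +oo].

(* An Orlicz function evaluated at a norm or at a rearrangement, which are
   extended reals. At infinity it takes its limit, which is [+oo] unless
   [Phi] vanishes identically, a case the definition does not exclude. *)
Definition Orlicz_ext Phi (x : \bar R) : \bar R :=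
  if x is r%:E then (Phi r)%:E else ereal_sup (range (EFin \o Phi)).

End Orlicz.

Section functions_on_half_line.
Variable R : realType.

(* Indices are shifted to start at 0, so the k-th function lives on (k, k+1). *)
Definition disjoint_sum n (f : 'I_n -> R -> R) (t : R) : R :=
  \sum_(k < n) (if k%:R < t < k.+1%:R then f k (t - k%:R) else 0).

Local Open Scope ereal_scope.

Definition rearrangement (g : R -> R) (t : R) : \bar R :=
  ereal_inf [set u%:E | u in [set u : R | (0 <= u)%R /\
    half_line [set s : lebesgueType R | (u < `|g s|)%R] <= t%:E]].

Definition norm_L1 (f : R -> R) : \bar R := 'N[half_line]_1[EFin \o f].

Definition norm_L1_L2 (f : R -> R) : \bar R :=
  ereal_inf [set x | exists g h : lebesgueType R -> R,
    [/\ g \in Lfun half_line 1, h \in Lfun half_line 2%:E,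
        {ae half_line, forall t, f t = (g t + h t)%R}
      & x = 'N[half_line]_1[EFin \o g] + 'N[half_line]_2%:E[EFin \o h]]].

Definition equiv_upto (C : R) (X Y : \bar R) :=
  X <= C%:E * Y /\ Y <= C%:E * X.

End functions_on_half_line.

(* Main.v *)
Require Import Defs.
From HB Require Import structures.
From mathcomp Require Import all_boot all_order all_algebra.
From mathcomp Require Import all_classical all_reals all_analysis.
From mathcomp Require Import measurable_realfun ring lra.

(** Write [S] for the sum of the [f_k], [d u = sum_k P(|f_k| > u)] for the tail of
    [|F|], and note that [mu(F)] on (0,1) has tail [min 1 (d u)].

    Since [prod (1 - p_k) <= 1 / (1 + sum p_k)], that tail is comparable to the
    tail of [max_k |f_k|], which is dominated by the tail of [|S|]: trivially for
    positive variables, by Levy's inequality for symmetric ones.  By convexity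
    [Phi (E|S| / 2) <= E Phi(S)], so for the lower bounds it remains to bound the
    norm of [F] by a multiple of [E|S|].  In the symmetric case [F] is cut at the
    level [a = 5 E|S|]: the large part is controlled in [L_1] by the tail
    comparison, the small part in [L_2] because its sum [S'] satisfies
    [E (1 - cos (S'/a)) = 1 - prod_k E cos (f'_k/a)] and [E|S'| <= E|S|].

    For the upper bounds the variables are truncated at a level [a] with
    [d a <= 1], comparable to the norm of [F].  The small parts have a bounded
    exponential moment at scale [a], and [Phi (t a) <= K exp(t) Phi a] by Delta_2.
    If [N] variables exceed [a], their sum contributes at most
    [K exp(N) sum_k Phi(f_k) 1_{|f_k| > a}].  Both expectations factorise by
    independence. *)
Set Implicit Arguments.
Unset Strict Implicit.
Unset Printing Implicit Defensive.

Import Order.TTheory GRing.Theory Num.Theory.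
Import numFieldNormedType.Exports.

Local Open Scope classical_set_scope.
Local Open Scope ring_scope.

(** The two norms reflect two treatments of the linear term in exp y <= 1 + y + 2 y^2, valid for |y|
    <= 1/2. Kept in modulus, it makes the exponential moments cost the L_1 norm of the small part;
    cancelled by symmetry, it leaves only second moments. For the converse in the symmetric case an
    L_2 bound must come out of a first moment of the sum. The function 1 - cos bridges this gap: it
    is at most |x| everywhere and at least x^2/8 for |x| <= 1. The factor 5 serves twice: Markov's
    inequality and the tail comparison, whose constant is 4, give d a <= 4/5 < 1, and the product of
    the cosine means stays above 4/5. [Phi] is compared through superlevel sets: {Phi > s} is {|r| >
    u} for a suitable u, so tail inequalities at all levels integrate to inequalities for [Phi],
    infinite values included. Norms may be zero, infinite or infima that are not attained. Upper
    bounds are therefore proved at every real level above the norm, and Delta_2 pays for the passage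
    to the norm itself. The zero function [Phi] is set apart, since its extension to infinity is 0
    and not infinite. *)

Section layer_cake.
Context d (T : measurableType d) (R : realType).
Variable mu : {sigma_finite_measure set T -> \bar R}.
Local Open Scope ereal_scope.

(** Tonelli for the indicator of [0 <= s < g x] times [W x]. The passive weight [W] will be the
    product of the other factors in an independence argument, or the indicator of a second event. *)
Lemma layer_cake (g : T -> R) (W : T -> \bar R) :
  measurable_fun setT g -> (forall x, 0 <= g x)%R ->
  measurable_fun setT W -> (forall x, 0 <= W x) ->
  \int[mu]_x ((g x)%:E * W x) =
  \int[lebesgue_measure]_(s in `[0%R, +oo[)
     \int[mu]_x (((s < g x)%R%:R)%:E * W x).
Proof.
move=> mg g0 mW W0.
pose F (z : T * measurableTypeR R) : \bar R :=
  (((0 <= z.2)%R && (z.2 < g z.1)%R)%:R)%:E * W z.1.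
have mF : measurable_fun setT F.
  apply: emeasurable_funM; last exact: measurableT_comp.
  apply/measurable_EFinP.
  pose fsnd (p : T * measurableTypeR R) := (0 <= p.2)%R.
  pose f21 (p : T * measurableTypeR R) := (p.2 < g p.1)%R.
  rewrite [X in measurable_fun _ X](_ : _ =
      \1_(fsnd @^-1` [set true] `&` f21 @^-1` [set true])); last first.
    apply/funext => p; rewrite indicE /fsnd /f21; congr (_%:R).
    apply/esym; case: (boolP (_ && _)) => [/andP[a b]|nab].
      by rewrite mem_set.
    by rewrite memNset//= => -[a b]; move: nab; rewrite a b.
  apply: measurable_indic; apply: measurableI.
  - have : measurable_fun setT fsnd by exact: measurable_fun_ler.
    by move=> /(_ measurableT [set true]); rewrite setTI; exact.
  - have : measurable_fun setT f21.
      by apply: measurable_fun_ltr => //; exact: measurableT_comp.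
    by move=> /(_ measurableT [set true]); rewrite setTI; exact.
have F0 z : 0 <= F z by rewrite mule_ge0.
transitivity (\int[mu]_x \int[lebesgue_measure]_s F (x, s)).
  apply: eq_integral => x _; rewrite /F/=.
  rewrite ge0_integralZr//.
  - congr (_ * _).
    transitivity (\int[@lebesgue_measure R]_s (\1_`[0%R, g x[ s)%:E).
      rewrite integral_indic// setIT.
      transitivity (@lebesgue_measure R `[0%R, g x[%classic) => //.
      rewrite lebesgue_measure_itv/= lte_fin.
      by move: (g0 x); rewrite le_eqVlt => /orP[/eqP <-|->]; rewrite ?ltxx ?sube0.
    by apply: eq_integral => s _; rewrite indicE mem_setE/= in_itv.
  - apply/measurable_EFinP.
    rewrite [X in measurable_fun _ X](_ : _ = \1_`[0%R, g x[); last first.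
      by apply/funext => s; rewrite indicE mem_setE/= in_itv.
    exact: measurable_indic.
rewrite (@fubini_tonelli _ _ _ _ _ mu lebesgue_measure F mF F0).
rewrite [RHS]integral_mkcond.
apply: eq_integral => s _; rewrite patchE/=.
case: ifPn; rewrite mem_setE in_itv/= andbT => s0; last first.
  by apply: integral0_eq => x _; rewrite /F/= (negbTE s0) mul0e.
by apply: eq_integral => x _; rewrite /F/= s0.
Qed.

End layer_cake.

(** * Factorisation of expectations under independence *)

Section independence.
Context d (T : measurableType d) (R : realType) (P : probability T R).
Local Open Scope ereal_scope.

Lemma integral_indic_preimage (X : T -> measurableTypeR R)
    (B : set (measurableTypeR R)) : measurable_fun setT X -> measurable B ->
  \int[P]_x (\1_B (X x))%:E = P (X @^-1` B).
Proof.
move=> mX mB; have mXB : measurable (X @^-1` B).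
  by rewrite -[X in measurable X]setTI; exact: mX.
by rewrite -[in RHS](setIT (_ @^-1` _)) -integral_indic.
Qed.

(** Passes from indicators to any [h >= 0] through the superlevel sets of [h], without simple
    functions. [W] stands for the product of the remaining factors and [c] for its expectation,
    possibly infinite. *)
Lemma integral_comp_weight (X : T -> measurableTypeR R) (W : T -> \bar R)
    (c : \bar R) :
  measurable_fun setT X -> measurable_fun setT W -> (forall x, 0 <= W x) ->
  0 <= c ->
  (forall B : set (measurableTypeR R), measurable B ->
     \int[P]_x ((\1_B (X x))%:E * W x) = P (X @^-1` B) * c) ->
  forall h : measurableTypeR R -> R, measurable_fun setT h ->
    (forall r, 0 <= h r)%R ->
  \int[P]_x ((h (X x))%:E * W x) = \int[P]_x (h (X x))%:E * c.
Proof.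
move=> mX mW W0 c0 XW h mh h0.
have mhX : measurable_fun setT (h \o X) by exact: measurableT_comp.
rewrite -ge0_integralZr//; last 2 first.
- exact/measurable_EFinP.
- by move=> x _; rewrite lee_fin.
rewrite !layer_cake//.
apply: eq_integral => s _.
pose B : set (measurableTypeR R) := [set r | (s < h r)%R].
have mB : measurable B.
  have : measurable_fun setT (fun r => (s < h r)%R) by exact: measurable_fun_ltr.
  by move=> /(_ measurableT [set true]); rewrite setTI; exact.
have EB x : ((s < h (X x))%R%:R = \1_B (X x) :> R)%R.
  by rewrite indicE mem_setE.
under eq_integral do rewrite EB.
under [RHS]eq_integral do rewrite EB.
have mXB : measurable (X @^-1` B) by rewrite -[X in measurable X]setTI; exact: mX.
rewrite XW// ge0_integralZr//.
  by rewrite integral_indic_preimage.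
apply/measurable_EFinP.
exact: (measurableT_comp (measurable_indic mB) mX).
Qed.

Variables (n : nat) (X : 'I_n -> {RV P >-> measurableTypeR R}).
Hypothesis indepX : independent_RVs X.

Lemma expectation_prod (h : 'I_n -> measurableTypeR R -> R) :
  (forall k, measurable_fun setT (h k)) -> (forall k r, 0 <= h k r)%R ->
  \int[P]_x (\prod_k h k (X k x))%R%:E = \prod_k \int[P]_x (h k (X k x))%:E.
Proof.
(* Induction on the number [j] of leading positions allowed to carry an arbitrary function, the
   others carrying indicators. At [j = 0] the claim is the definition of independence; each step
   frees one more position by [integral_comp_weight]. *)
suff H (j : nat) : forall h : 'I_n -> measurableTypeR R -> R,
    (forall k, measurable_fun setT (h k)) -> (forall k r, 0 <= h k r)%R ->
    (forall k : 'I_n, (j <= k)%N ->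
       exists2 B : set (measurableTypeR R), measurable B & h k = \1_B) ->
    \int[P]_x (\prod_k h k (X k x))%R%:E = \prod_k \int[P]_x (h k (X k x))%:E.
  by move=> mh h0; apply: (H n) => // k; rewrite leqNgt ltn_ord.
elim: j => [|j IH] {}h mh h0 hB.
  have /choice[B hB'] : forall k, exists B : set (measurableTypeR R),
      measurable B /\ h k = \1_B.
    by move=> k; have [B mB ->] := hB k isT; exists B.
  have mXB k : measurable (X k @^-1` B k).
    by rewrite -[X in measurable X]setTI; apply: measurable_funPT => //; exact: (hB' k).1.
  have E k : \int[P]_x (h k (X k x))%:E = P (X k @^-1` B k).
    by rewrite (hB' k).2 integral_indic_preimage //; exact: (hB' k).1.
  under [RHS]eq_bigr do rewrite E.
  have := indepX [set: 'I_n]%SET (fun k => (hB' k).1).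
  under [X in _ = X]eq_bigl do rewrite finset.in_setT.
  move=> <-.
  rewrite -[X in P X]setIT -integral_indic//; last first.
    by apply: fin_bigcap_measurable => // k _; exact: mXB.
  apply: eq_integral => x _; congr (_%:E).
  rewrite indicE; case: (boolP (x \in _)) => [/set_mem xB|xB].
    rewrite big1// => k _; rewrite (hB' k).2 indicE mem_set//.
    by apply: xB => /=; rewrite finset.in_setT.
  have [k kB] : exists k, ~ B k (X k x).
    apply/existsNP => xall; move/negP: xB; apply; apply/mem_set => k _.
    exact: xall.
  by rewrite (bigD1 k)//= (hB' k).2 indicE memNset// mul0r.
have [jn|nj] := ltnP j n; last first.
  by apply: IH => // k jk; move: (ltn_ord k); rewrite ltnNge (leq_trans nj).
pose i := Ordinal jn.
pose W x := (\prod_(k | k != i) h k (X k x))%R%:E.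
pose c := \prod_(k | k != i) \int[P]_x (h k (X k x))%:E.
rewrite (bigD1 i)//= -/c.
under eq_integral => x _ do rewrite (bigD1 i)//= EFinM -/(W x).
apply: integral_comp_weight => //.
- apply/measurable_EFinP.
  rewrite [X in measurable_fun _ X](_ : _ =
      fun x => \prod_k if k != i then h k (X k x) else 1)%R.
    apply: measurable_prod => k _; case: (k != i) => //.
    exact: measurableT_comp.
  by apply/funext => x; rewrite big_mkcond.
- by move=> x; rewrite lee_fin prodr_ge0.
- by apply: prode_ge0 => k _; apply: integral_ge0 => x _; rewrite lee_fin.
move=> B mB.
have mXB : measurable (X i @^-1` B).
  by rewrite -[X in measurable X]setTI; exact: measurable_funPT.
pose h' k := if k == i then \1_B else h k.
have h'i : h' i = \1_B by rewrite /h' eqxx.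
have h'E k : k != i -> h' k = h k by rewrite /h' => /negbTE ->.
transitivity (\int[P]_x (\prod_k h' k (X k x))%R%:E).
  apply: eq_integral => x _; rewrite (bigD1 i)//= h'i EFinM; congr (_ * _%:E).
  by apply: eq_bigr => k ki; rewrite h'E.
rewrite IH.
- rewrite (bigD1 i)//= h'i integral_indic_preimage//; congr (_ * _).
  by apply: eq_bigr => k ki; rewrite h'E.
- by move=> k; rewrite /h'; case: ifP => // _; exact: measurable_indic.
- by move=> k r; rewrite /h'; case: ifP => // _; rewrite indicE.
- move=> k jk; rewrite /h'; case: ifPn => [_|ki]; first by exists B.
  by apply: hB; rewrite ltn_neqAle jk andbT; apply: contra ki => /eqP jk'; apply/eqP/val_inj.
Qed.

End independence.

(** * Joint laws and their invariance under coordinatewise maps *)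

Section joint_law.
Context (R : realType) (n : nat).

(** Generator of the product sigma-algebra on n-tuples. Boxes are stable under intersection and
    include the whole space, so a finite measure is determined by its values on them. *)
Definition rectangles : set (set ('I_n -> measurableTypeR R)) :=
  [set A | exists2 B : 'I_n -> set (measurableTypeR R),
     (forall k, measurable (B k)) & A = [set v | forall k, B k (v k)]].

Local Notation jointType := (g_sigma_algebraType rectangles).

Lemma measurable_coord k :
  measurable_fun setT ((fun v => v k) : jointType -> measurableTypeR R).
Proof.
move=> _ B mB; rewrite setTI; apply: sub_sigma_algebra.
exists (fun j => if j == k then B else setT) => [j|]; first by case: ifP.
apply/seteqP; split => v/= Bv; last by have := Bv k; rewrite eqxx.
by move=> j; case: ifPn => // /eqP ->.
Qed.

Lemma measurable_joint d (T : measurableType d)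
    (X : 'I_n -> T -> measurableTypeR R) :
  (forall k, measurable_fun setT (X k)) ->
  measurable_fun setT ((fun x => X ^~ x) : T -> jointType).
Proof.
move=> mX; apply: (@measurability _ _ T jointType setT _ rectangles) => //.
move=> _ [_ [B mB ->] <-]; rewrite setTI.
have -> : (fun x k => X k x) @^-1` [set v | forall k, B k (v k)] =
    \bigcap_(k in [set: 'I_n]) (X k @^-1` B k).
  by apply/seteqP; split => x /= Bx k; [move=> _; exact: Bx|exact: Bx].
apply: fin_bigcap_measurable => // k _.
by rewrite -[X in measurable X]setTI; exact: mX.
Qed.

Context d (T : measurableType d) (P : probability T R).
Variable X : 'I_n -> {RV P >-> measurableTypeR R}.
Hypothesis indepX : independent_RVs X.

(** [Y] consists of bare functions rather than bundled random variables, so that the factorisation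
    applies to [tau k \o X k] as well as to [X k]. *)
Lemma rectangle_prob (Y : 'I_n -> T -> measurableTypeR R) B :
  (forall (J : {set 'I_n}) (B : 'I_n -> set (measurableTypeR R)),
    (forall k, measurable (B k)) ->
    P (\bigcap_(k in [set k | k \in J]) (Y k @^-1` B k)) =
    (\prod_(k in J) P (Y k @^-1` B k))%E) ->
  (forall k, measurable (B k)) ->
  P ((fun x k => Y k x) @^-1` [set v | forall k, B k (v k)]) =
  (\prod_k P (Y k @^-1` B k))%E.
Proof.
move=> indepY mB.
have -> : (fun x k => Y k x) @^-1` [set v | forall k, B k (v k)] =
    \bigcap_(k in [set k | k \in [set: 'I_n]%SET]) (Y k @^-1` B k).
  by apply/seteqP; split => x /= Bx k; [move=> _|];
    apply: (Bx k) => //; rewrite /= inE.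
by rewrite indepY//; apply: eq_bigl => k; rewrite inE.
Qed.

(** Transforming each coordinate separately keeps independence, because an event on [tau k \o X k]
    is an event on [X k]. With unchanged marginals the two joint laws agree on boxes, hence
    everywhere. It serves for sign changes and for the reflection of large values. *)
Lemma joint_law_invariant
    (tau : 'I_n -> measurableTypeR R -> measurableTypeR R)
    (G : jointType -> \bar R) :
  (forall k, measurable_fun setT (tau k)) ->
  (forall k B, measurable B -> P ((tau k \o X k) @^-1` B) = P (X k @^-1` B)) ->
  measurable_fun setT G -> (forall v, 0 <= G v)%E ->
  (\int[P]_x G (fun k => tau k (X k x)) = \int[P]_x G (fun k => X k x))%E.
Proof.
move=> mtau tauX mG G0.
pose phi x : jointType := fun k => X k x.
pose psi x : jointType := fun k => tau k (X k x).
have mphi : measurable_fun setT phi by exact: measurable_joint.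
have mpsi : measurable_fun setT psi.
  by apply: measurable_joint => k; exact: measurableT_comp.
transitivity (\int[pushforward P psi]_v G v)%E.
  by rewrite ge0_integral_pushforward.
transitivity (\int[pushforward P phi]_v G v)%E; last first.
  by rewrite ge0_integral_pushforward.
apply: eq_measure_integral => A mA _.
apply: (@measure_unique _ R jointType rectangles (fun=> setT)) => //.
- move=> _ _ [B mB ->] [C mC ->]; exists (fun k => B k `&` C k).
    by move=> k; exact: measurableI.
  apply/seteqP; split => v /=; first by move=> [Bv Cv] k; split.
  by move=> BC; split=> k; case: (BC k).
- by move=> _; exists (fun=> setT) => //; apply/seteqP.
- by rewrite bigcup_const//; exists 0%N.
- move=> _ [B mB ->]; rewrite /pushforward.
  transitivity (\prod_k P ((tau k \o X k) @^-1` B k))%E.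
    apply: (rectangle_prob (Y := fun k => tau k \o X k)) => // J {mB}B mB.
    rewrite (indepX J (B := fun k => tau k @^-1` B k))// => k.
    by rewrite -[X in measurable X]setTI; exact: mtau.
  rewrite (eq_bigr _ (fun k _ => tauX k _ (mB k))); apply/esym.
  exact: (rectangle_prob (Y := X)).
- by move=> _; apply: (le_lt_trans (probability_le1 P _)); rewrite ?ltry//; exact: measurableT.
Qed.

End joint_law.

(** * Orlicz functions: convexity, superlevel sets, growth *)

Section Orlicz_functions.
Variables (R : realType) (Phi : R -> R).
Hypothesis hPhi : Orlicz_function Phi.

Lemma Orlicz_even t : Phi (- t) = Phi t. Proof. by case: hPhi. Qed.

Lemma Orlicz_ge0 t : 0 <= Phi t. Proof. by case: hPhi. Qed.

Lemma Orlicz0 : Phi 0 = 0. Proof. by case: hPhi. Qed.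

Lemma Orlicz_convex (l x y : R) : 0 <= l -> l <= 1 ->
  Phi (l * x + (1 - l) * y) <= l * Phi x + (1 - l) * Phi y.
Proof.
move=> l0 l1; case: hPhi => _ cPhi _ _.
exact: (cPhi (Itv01 l0 l1) x y (in_setT _) (in_setT _)).
Qed.

Lemma Orlicz_star (l x : R) : 0 <= l -> l <= 1 -> Phi (l * x) <= l * Phi x.
Proof.
move=> l0 l1; have := Orlicz_convex x 0 l0 l1.
by rewrite Orlicz0 !mulr0 !addr0.
Qed.

Lemma Orlicz_homo (x y : R) : 0 <= x -> x <= y -> Phi x <= Phi y.
Proof.
move=> x0; rewrite le_eqVlt => /predU1P[->//|xy].
have y0 : 0 < y by exact: le_lt_trans xy.
have l1 : x / y <= 1 by rewrite ler_pdivrMr// mul1r ltW.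
have := Orlicz_star y (divr_ge0 x0 (ltW y0)) l1.
rewrite divfK ?gt_eqF// => /le_trans; apply.
by rewrite ler_piMl// Orlicz_ge0.
Qed.

Lemma Orlicz_norm (x : R) : Phi `|x| = Phi x.
Proof. by have [//|_] := ger0P x; rewrite Orlicz_even. Qed.

Lemma Orlicz_homo_norm (x y : R) : `|x| <= `|y| -> Phi x <= Phi y.
Proof.
by move=> xy; rewrite -(Orlicz_norm x) -(Orlicz_norm y) Orlicz_homo.
Qed.

Lemma measurable_Orlicz :
  measurable_fun setT (Phi : measurableTypeR R -> measurableTypeR R).
Proof.
pose g (v : R) := Phi (Num.max v 0).
have -> : Phi = g \o Num.norm.
  by apply/funext => v; rewrite /g /= max_l// Orlicz_norm.
apply: (@measurableT_comp _ _ _ _ _ _ g); last exact: normr_measurable.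
apply: nondecreasing_measurable => // x y xy.
apply: Orlicz_homo; first by rewrite le_max lexx orbT.
by rewrite ge_max !le_max xy lexx orbT.
Qed.

(* Below [u] the bound [Phi <= s] survives at [u] itself because a convex
   function is left continuous. *)
Lemma Orlicz_superlevel (s : R) : 0 <= s -> ~ (forall t, Phi t = 0) ->
  exists2 u, 0 <= u & forall v, 0 <= v -> (s < Phi v) = (u < v).
Proof.
move=> s0 /existsNP[b /eqP b0].
wlog {b0} : b / 0 < b /\ 0 < Phi b.
  move=> /(_ `|b|); apply; rewrite Orlicz_norm [0 < Phi b]lt_neqAle eq_sym b0.
  rewrite Orlicz_ge0 normr_gt0; split => //.
  by apply: contra_neq b0 => ->; rewrite Orlicz0.
move=> [b0 Pb0].
(* Beyond a point where [Phi] is positive, convexity and [Phi 0 = 0] force at least linear growth,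
   so the sublevel set [E] is bounded. *)
have Plin v : b <= v -> v * (Phi b / b) <= Phi v.
  move=> bv; have v0 : 0 < v by exact: lt_le_trans bv.
  have l1 : b / v <= 1 by rewrite ler_pdivrMr// mul1r.
  have := Orlicz_star v (divr_ge0 (ltW b0) (ltW v0)) l1.
  rewrite divfK ?gt_eqF// => h.
  rewrite mulrA ler_pdivrMr//; apply: le_trans (ler_wpM2l (ltW v0) h) _.
  by rewrite le_eqVlt; apply/orP; left; apply/eqP; field; rewrite gt_eqF.
pose E := [set v | 0 <= v /\ Phi v <= s].
have E0 : E 0 by split; rewrite ?Orlicz0.
pose m := Num.max b ((s + 1) / (Phi b / b)).
have mP : s < Phi m.
  apply: lt_le_trans (Plin m _); last by rewrite le_max lexx.
  apply: (@lt_le_trans _ _ (s + 1)); first by rewrite ltrDl.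
  by rewrite -ler_pdivrMr ?divr_gt0// le_max lexx orbT.
have m0 : 0 <= m by rewrite le_max ltW.
have Em v : E v -> v <= m.
  move=> [v0 vs]; rewrite leNgt; apply/negP => mv.
  by have := lt_le_trans mP (Orlicz_homo m0 (ltW mv)); rewrite ltNge vs.
have supE : has_sup E by split; [exists 0|exists m].
have u0 : 0 <= sup E by exact: sup_ubound supE.2 _ E0.
exists (sup E) => // v v0; apply/idP/idP => [sv|uv]; last first.
  rewrite ltNge; apply/negP => vs.
  by move: uv; rewrite ltNge => /negP; apply; apply: sup_ubound supE.2 _ _.
rewrite ltNge; apply/negP => vu.
suff : Phi (sup E) <= s by rewrite leNgt (lt_le_trans sv)// Orlicz_homo.
rewrite leNgt; apply/negP => su.
set u := sup E in vu su u0.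
(* Some [w] in [E] lies within [e] of [u]. Since [u] is the convex combination of [u + 1] and [w]
   with weight [l <= u - w], this gives [Phi u <= (u - w) * Phi (u + 1) + s < Phi u]. The [+ 1]
   keeps the denominator positive. *)
pose e := (Phi u - s) / (Phi (u + 1) + 1).
have Pu1 : 0 < Phi (u + 1) + 1 by rewrite ltr_wpDl// Orlicz_ge0.
have e0 : 0 < e by rewrite divr_gt0// subr_gt0.
have [w [w0 ws] uw] := sup_adherent e0 supE.
have wu : w <= u by apply: sup_ubound supE.2 _ _.
pose l := (u - w) / (u + 1 - w).
have d0 : 0 < u + 1 - w by rewrite subr_gt0 ltr_pwDr.
have l0 : 0 <= l by apply: divr_ge0; [rewrite subr_ge0|exact: ltW].
have l1 : l <= 1 by rewrite /l ler_pdivrMr// mul1r; lra.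
have le : l <= u - w by rewrite /l ler_pdivrMr// ler_peMr ?subr_ge0//; lra.
have := Orlicz_convex (u + 1) w l0 l1.
have -> : l * (u + 1) + (1 - l) * w = u.
  by rewrite /l; field; rewrite gt_eqF.
have lP : l * Phi (u + 1) <= (u - w) * Phi (u + 1).
  by rewrite ler_wpM2r// Orlicz_ge0.
have eP : (u - w) * (Phi (u + 1) + 1) < Phi u - s.
  by rewrite -ltr_pdivlMr// -/e; move: uw; rewrite -/u; lra.
have wP : (1 - l) * Phi w <= s.
  apply: le_trans ws; rewrite ler_piMl ?Orlicz_ge0//; lra.
lra.
Qed.

Section Delta2.
Variable D : R.
Hypothesis D0 : 0 <= D.
Hypothesis PhiD : forall t, Phi (2 * t) <= D * Phi t.

Lemma Delta2_expn (j : nat) t : Phi (2 ^+ j * t) <= D ^+ j * Phi t.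
Proof.
elim: j => [|j IH]; first by rewrite !expr0 !mul1r.
rewrite !exprS -!mulrA; apply: le_trans (PhiD _) _.
by rewrite ler_wpM2l.
Qed.

Lemma Orlicz_splitD x y : Phi (x + y) <= D * (Phi x + Phi y).
Proof.
have -> : x + y = 2^-1 * (2 * x) + (1 - 2^-1) * (2 * y) by field.
apply: le_trans (Orlicz_convex _ _ _ _) _; [lra|lra|].
have := PhiD x; have := PhiD y; have := Orlicz_ge0 x; have := Orlicz_ge0 y.
have := Orlicz_ge0 (2 * x); have := Orlicz_ge0 (2 * y).
lra.
Qed.

(* With [D <= 2^q] doubling [j] times costs [D^j <= (2^j)^q], a power of the
   dilation factor, and powers grow slower than the exponential. *)
Lemma Orlicz_exp_growth : exists2 K, 0 < K &
  forall t A, 0 <= t -> 0 <= A -> Phi (t * A) <= K * expR t * Phi A.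
Proof.
have [q Dq] : exists q : nat, D <= 2 ^+ q.
  exists (Num.truncn D).+1; apply/ltW/(lt_le_trans (truncnS_gt _)).
  by rewrite -natrX ler_nat ltnW// ltn_expl.
(* The power of 2 comes from raising [2 ^+ j.+1 <= 2 * t] to the exponent [q.+1], the factorial from
   bounding [t ^+ q.+1] by a multiple of [expR t]. *)
pose K := 2 ^+ q.+1 * (q.+1)`!%:R : R.
have K1 : 1 <= K.
  rewrite /K -natrX -natrM ler1n muln_gt0 expn_gt0 fact_gt0//.
have K0 : 0 < K by lra.
exists K => // t A t0 A0.
have [t1|t1] := leP t 1.
  apply: (@le_trans _ _ (Phi A)).
    by apply: Orlicz_homo; [exact: mulr_ge0|rewrite ler_piMl].
  rewrite ler_peMl ?Orlicz_ge0// -[1]mulr1 ler_pM//.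
  by have := expR_ge1Dx t; lra.
have [j /andP[jt tj]] : exists j : nat, (2 ^+ j <= t) && (t < 2 ^+ j.+1).
  have ex : exists j : nat, t < 2 ^+ j.+1.
    exists (Num.truncn t); apply/(lt_le_trans (truncnS_gt _)).
    by rewrite -natrX ler_nat ltnW// ltn_expl.
  exists (ex_minn ex); case: ex_minnP => [[|j] tj jmin]; rewrite tj andbT.
    by rewrite expr0 ltW.
  by rewrite leNgt; apply/negP => /jmin; rewrite ltnn.
apply: (@le_trans _ _ (Phi (2 ^+ j.+1 * A))).
  by apply: Orlicz_homo; [exact: mulr_ge0|rewrite ler_wpM2r// ltW].
apply: le_trans (Delta2_expn _ _) _.
rewrite ler_wpM2r ?Orlicz_ge0//.
apply: (@le_trans _ _ ((2 ^+ q) ^+ j.+1)); first by rewrite lerXn2r ?nnegrE ?exprn_ge0.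
rewrite -exprM mulnC exprM.
have h1 : (2 ^+ j.+1 : R) ^+ q <= (2 ^+ j.+1) ^+ q.+1.
  by rewrite ler_weXn2l// exprn_ege1// ler1n.
have h2 : (2 ^+ j.+1 : R) ^+ q.+1 <= (2 * t) ^+ q.+1.
  by rewrite lerXn2r ?nnegrE ?exprn_ge0 ?mulr_ge0// exprS ler_wpM2l.
apply: le_trans h1 (le_trans h2 _).
rewrite exprMn /K -mulrA ler_wpM2l ?exprn_ge0//.
have := expR_ge1Dxn q t0.
rewrite -ler_pdivrMl ?ltr0n ?fact_gt0// mulrC; lra.
Qed.

End Delta2.

End Orlicz_functions.

(** * Translation invariance of Lebesgue measure, integrals of disjoint sums *)

Section translation.
Variable R : realType.
Local Open Scope ereal_scope.

Let outer : set (ocitv_type R) -> \bar R := ((wlength (@idfun R))^*)%mu.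

Let translate (c : R) (A : set R) : set R := [set t | A (t + c)%R].

(** A countable cover by half-open intervals translates to one of the same total length. Used for
    [c] and [- c], this inequality yields equality. *)
Let outer_translate_le c A : outer (translate c A) <= outer A.
Proof.
apply/ereal_infP => _ [F [mF AF] <-]; apply: ge_ereal_inf.
have tE i : exists2 x : R * R, F i = `]x.1, x.2]%classic &
    translate c (F i) = `](x.1 - c)%R, (x.2 - c)%R]%classic.
  have [x _ Fx] := mF i; exists x => //.
  by apply/seteqP; split => t; rewrite /translate -Fx/= !in_itv/= ltrBlDr lerBrDr.
exists (\sum_(i <oo) wlength idfun (translate c (F i))); last first.
  rewrite le_eqVlt; apply/orP; left; apply/eqP.
  apply: eq_eseriesr => i _; have [x -> ->] := tE i.
  rewrite !wlength_itv/= !lte_fin ltrD2r; case: ifP => // _.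
  by rewrite -!EFinB; congr (_%:E); ring.
exists (fun i => translate c (F i)) => //.
  split=> [i|t At]; first by have [x _ ->] := tE i; exact: is_ocitv.
by have [i _ Fi] := AF _ At; exists i.
Qed.

Let translateK c A : translate c (translate (- c) A) = A.
Proof. by apply/funext => t; rewrite /translate/= addrK. Qed.

Let outer_translate c A : outer (translate c A) = outer A.
Proof.
apply/eqP; rewrite eq_le outer_translate_le/=.
by have := outer_translate_le (- c) (translate c A); rewrite -{2}(opprK c) translateK.
Qed.

(** The sigma-algebra holds all Lebesgue sets, so continuity of the map does not suffice. The
    Caratheodory criterion is transported instead: the outer measure is translation invariant and
    every test set is a translate. *)
Lemma measurable_translate (c : R) :
  measurable_fun setT ((fun t => t + c)%R : lebesgueType R -> lebesgueType R).
Proof.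
move=> _ A mA; rewrite setTI.
have cA X : outer X = outer (X `&` A) + outer (X `&` ~` A) := mA X.
suff cB X : outer X =
    outer (X `&` translate c A) + outer (X `&` ~` translate c A) by exact: cB.
rewrite -(translateK c X); move: (translate (- c) X) => Y.
have -> : translate c Y `&` translate c A = translate c (Y `&` A) by [].
have -> : translate c Y `&` ~` translate c A = translate c (Y `&` ~` A) by [].
rewrite !outer_translate; exact: cA.
Qed.

Lemma leb_translate (c : R) (A : set (lebesgueType R)) :
  leb ((fun t => t + c)%R @^-1` A) = leb A.
Proof. exact: outer_translate. Qed.

Lemma ge0_integral_leb_translate (c : R) (D : set (lebesgueType R))
    (g : lebesgueType R -> \bar R) :
  measurable D -> measurable_fun D g -> (forall t, D t -> 0 <= g t) ->
  \int[leb]_(t in (fun t => t + c)%R @^-1` D) g (t + c)%R = \int[leb]_(t in D) g t.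
Proof.
move=> mD mg g0.
pose phi : lebesgueType R -> lebesgueType R := fun t => (t + c)%R.
have mphi : measurable_fun setT phi by exact: measurable_translate.
transitivity (\int[pushforward leb phi]_(t in D) g t).
  rewrite ge0_integral_pushforward//.
  by move=> t; rewrite inE; exact: g0.
by apply: eq_measure_integral => A mA _; exact: (leb_translate c A).
Qed.

End translation.

Section integral_mrestr.
Context d (T : measurableType d) (R : realType).
Variables (mu : {measure set T -> \bar R}) (D : set T) (mD : measurable D).
Local Open Scope ereal_scope.

Lemma ge0_integral_mrestr (g : T -> \bar R) :
  measurable_fun setT g -> (forall t, 0 <= g t) ->
  \int[mrestr mu mD]_t g t = \int[mu]_(t in D) g t.
Proof.
move=> mg g0.
rewrite -(setUv D) ge0_integral_setU//=; last 3 first.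
- exact: measurableC.
- by rewrite setUv.
- by apply/eqP; rewrite setICr.
rewrite [X in _ + X](_ : _ = 0) ?adde0; last first.
  rewrite -(integral_measure_zero (~` D) g); apply: eq_measure_integral.
  move=> A mA AD; rewrite /= /mrestr.
  suff -> : A `&` D = set0 by rewrite measure0.
  by rewrite disjoints_subset.
by apply: eq_measure_integral => A mA AD; rewrite /= /mrestr setIidl.
Qed.

End integral_mrestr.

Lemma integral_half_line (R : realType) (g : lebesgueType R -> \bar R) :
  measurable_fun setT g -> (forall t, 0 <= g t)%E ->
  (\int[half_line]_t g t = \int[leb]_(t in `]0%R, +oo[) g t)%E.
Proof. exact: ge0_integral_mrestr. Qed.

Lemma integral_unit_prob (R : realType) (g : lebesgueType R -> \bar R) :
  measurable_fun setT g -> (forall t, 0 <= g t)%E ->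
  (\int[unit_prob]_t g t = \int[leb]_(t in `]0%R, 1%R[) g t)%E.
Proof. exact: ge0_integral_mrestr. Qed.

Section disjoint_sums.
Context (R : realType) (n : nat).
Variable f : 'I_n -> lebesgueType R -> measurableTypeR R.
Hypothesis mf : forall k, measurable_fun setT (f k).

Let F : lebesgueType R -> measurableTypeR R := disjoint_sum (fun k => f k : R -> R).

Let block (k : nat) : set (lebesgueType R) := `]k%:R, k.+1%:R[%classic.

Let block_uniq (j k : nat) t : block j t -> block k t -> j = k.
Proof.
rewrite /block/= !in_itv/= => /andP[jt tj] /andP[kt tk]; apply/eqP.
rewrite eqn_leq; apply/andP; split; rewrite -ltnS -(ltr_nat R).
  exact: lt_trans jt tk.
exact: lt_trans kt tj.
Qed.

Let F_block (k : 'I_n) t : block k t -> F t = f k (t - k%:R).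
Proof.
move=> kt; rewrite /F /disjoint_sum (bigD1 k)//= ifT; last first.
  by move: kt; rewrite /block/= in_itv.
rewrite big1 ?addr0// => j jk; rewrite ifF//; apply/negbTE/negP => jt.
by move/eqP: jk; apply; apply/val_inj/(@block_uniq _ _ t); rewrite ?/block/= ?in_itv.
Qed.

Let F_out t : (forall k : 'I_n, ~ block k t) -> F t = 0.
Proof.
move=> tout; rewrite /F /disjoint_sum big1// => k _; rewrite ifF//.
by apply/negbTE/negP => kt; apply: (tout k); rewrite /block/= in_itv.
Qed.

Let measurable_shifted k :
  measurable_fun setT ((fun t => f k (t - k%:R)) : lebesgueType R -> measurableTypeR R).
Proof.
exact: (measurableT_comp (mf k) (@measurable_translate R (- k%:R))).
Qed.

(** The blocks are disjoint and [F] vanishes off them, so [G 0 = 0] lets composition with [G]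
    commute with the decomposition into blocks. *)
Let F_indic (G : R -> R) t : G 0 = 0 ->
  G (F t) = \sum_(k < n) \1_(block k) t * G (f k (t - k%:R)).
Proof.
move=> G0; have [[k kt]|tout] := pselect (exists k : 'I_n, block k t).
  rewrite (F_block kt) (bigD1 k)//= indicE mem_set// mul1r big1 ?addr0// => j jk.
  rewrite indicE memNset ?mul0r// => jt; move/eqP: jk; apply.
  exact/val_inj/(block_uniq jt kt).
rewrite F_out ?G0; last by move=> k kt; apply: tout; exists k.
by rewrite big1// => k _; rewrite indicE memNset ?mul0r// => kt; apply: tout; exists k.
Qed.

Lemma measurable_disjoint_sum : measurable_fun setT F.
Proof.
rewrite [X in measurable_fun _ X](_ : _ =
    fun t => \sum_(k < n) \1_(block k) t * f k (t - k%:R)).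
  apply: measurable_sum => k; apply: measurable_funM; last exact: measurable_shifted.
  by apply: measurable_indic; exact: lebesgue_measurable_itv.
by apply/funext => t; rewrite (F_indic (G := id)).
Qed.

(** Each block is moved back onto (0,1) by translation. Tails, the L_1 norm and truncated second
    moments of the disjoint sum thereby become sums of expectations over [k]. *)
Lemma ge0_integral_disjoint_sum (G : measurableTypeR R -> R) :
  measurable_fun setT G -> (forall r, 0 <= G r) -> G 0 = 0 ->
  (\int[half_line]_t (G (F t))%:E = \sum_k \int[unit_prob]_t (G (f k t))%:E)%E.
Proof.
move=> mG G_ge0 G0.
have mD k : measurable (block k) by exact: lebesgue_measurable_itv.
have mGf k : measurable_fun setT (fun t : lebesgueType R => G (f k t)).
  exact: measurableT_comp.
have mGs k : measurable_fun setT (fun t : lebesgueType R => G (f k (t - k%:R))).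
  exact: (measurableT_comp mG (measurable_shifted k)).
pose h (k : 'I_n) (t : lebesgueType R) := \1_(block k) t * G (f k (t - k%:R)).
have mh k : measurable_fun setT (EFin \o h k).
  by apply/measurable_EFinP; exact: measurable_funM.
have h0 k t : (0 <= (EFin \o h k) t)%E by rewrite lee_fin mulr_ge0.
transitivity (\int[half_line]_t \sum_(k < n) (EFin \o h k) t)%E.
  by apply: eq_integral => t _; rewrite (F_indic _ G0) sumEFin.
rewrite (ge0_integral_sum _ measurableT mh (fun k t _ => h0 k t)).
apply: eq_bigr => k _.
rewrite integral_half_line// integral_unit_prob; last 2 first.
- exact/measurable_EFinP.
- by move=> t; rewrite lee_fin.
transitivity (\int[leb]_(t in block k) (G (f k (t - k%:R)))%:E)%E.
  rewrite [LHS]integral_mkcond [RHS]integral_mkcond; apply: eq_integral => t _.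
  rewrite !patchE/= /h indicE; have [kt|kt] := pselect (block k t).
    rewrite !(mem_set kt) mul1r mem_set//=; move: kt.
    rewrite /block/= !in_itv/= andbT => /andP[kt _].
    exact: le_lt_trans kt.
  by rewrite !(memNset kt) mul0r if_same.
pose g (t : lebesgueType R) := (G (f k t))%:E.
have -> : block k =
    (fun t => t - k%:R) @^-1` (`]0, 1[%classic : set (lebesgueType R)).
  by apply/seteqP; split => t; rewrite /block/= !in_itv/= subr_gt0 ltrBlDr -natr1 addrC.
rewrite (@ge0_integral_leb_translate R (- k%:R) `]0, 1[%classic g)//.
- exact: lebesgue_measurable_itv.
- by apply: measurable_funTS; exact/measurable_EFinP.
- by move=> t _; rewrite lee_fin.
Qed.

End disjoint_sums.

(** * Decreasing rearrangements and their tails *)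

Lemma measurable_norm_gt d (T : measurableType d) (R : realType) (Y : T -> R)
    (u : R) : measurable_fun setT Y -> measurable [set t | u < `|Y t|].
Proof.
move=> mY.
have : measurable_fun setT (fun t => u < `|Y t|).
  apply: measurable_fun_ltr => //.
  exact: (measurableT_comp (@normr_measurable R setT) mY).
by move=> /(_ measurableT [set true]); rewrite setTI; exact.
Qed.

Lemma rearrangement_ge0 (R : realType) (F : R -> R) t :
  (0 <= rearrangement F t)%E.
Proof. by apply/ereal_infP => _ [u [u0 _] <-]; rewrite lee_fin. Qed.

Section rearrangement.
Variable R : realType.
Variable F : lebesgueType R -> measurableTypeR R.
Hypothesis mF : measurable_fun setT F.
Local Open Scope ereal_scope.

Let tail (u : R) : set (lebesgueType R) := [set s | (u < `|F s|)%R].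

Let measurable_tail u : measurable (tail u).
Proof. exact: (measurable_norm_gt u mF). Qed.

Let le_tail u v : (u <= v)%R -> half_line (tail v) <= half_line (tail u).
Proof.
move=> uv; apply: le_measure; rewrite ?inE//; try exact: measurable_tail.
by move=> s; exact: le_lt_trans.
Qed.

(** The infimum defining the rearrangement is attained because the tail is right continuous: the
    sets where [|F|] exceeds [u + 1/(k+1)] increase to the set where it exceeds [u]. *)
Lemma lt_rearrangement u t : (0 <= u)%R ->
  (u%:E < rearrangement F t) = (t%:E < half_line [set s | (u < `|F s|)%R]).
Proof.
move=> u0; apply/idP/idP; apply: contraTT; rewrite -!leNgt => h.
  by apply: ge_ereal_inf; exists u%:E => //; exists u.
pose E k := tail (u + k.+1%:R^-1).
have EE : \bigcup_k E k = tail u.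
  apply/seteqP; split => [s [k _]|s us].
    by apply: le_lt_trans; rewrite lerDl.
  have d0 : (0 < `|F s| - u)%R by rewrite subr_gt0.
  exists (Num.truncn (`|F s| - u)^-1) => //=.
  rewrite /E/tail/= -ltrBrDl -[ltRHS]invrK ltf_pV2 ?posrE ?invr_gt0//.
  exact: truncnS_gt.
have cE : half_line \o E @ \oo --> half_line (tail u).
  rewrite -EE; apply: nondecreasing_cvg_mu => //.
  - by move=> i; exact: measurable_tail.
  - by rewrite EE; exact: measurable_tail.
  - move=> j k jk; apply/subsetPset => s; apply: le_lt_trans.
    by rewrite lerD2l lef_pV2 ?posrE// ler_nat.
rewrite -/(tail u) -(cvg_lim _ cE)//; apply: lime_le; first by apply/cvg_ex; eexists; exact: cE.
apply: nearW => k /=; rewrite leNgt; apply/negP => tk.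
have : (u + k.+1%:R^-1)%:E <= rearrangement F t.
  apply/ereal_infP => _ [v [v0 vt] <-]; rewrite lee_fin leNgt; apply/negP => vk.
  by have := lt_le_trans tk (le_trans (le_tail (ltW vk)) vt); rewrite ltxx.
by move=> /le_trans /(_ h); rewrite lee_fin leNgt ltrDl invr_gt0 ltr0n.
Qed.

Hypothesis finF : half_line [set s | (0 < `|F s|)%R] < +oo.

(** An infinite value would keep every tail above [t], while continuity from above, available since
    the support has finite measure, sends the tails to 0. *)
Lemma rearrangement_lty t : (0 < t)%R -> rearrangement F t < +oo.
Proof.
move=> t0; rewrite ltNge leye_eq; apply/negP => /eqP ty.
have tk k : t%:E < half_line (tail k%:R) by rewrite -lt_rearrangement// ty ltry.
have capE : \bigcap_k tail k%:R = set0.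
  apply/seteqP; split => // s /(_ (Num.truncn `|F s|).+1 I).
  by rewrite /tail/= ltNge ltW// truncnS_gt.
have cE : half_line (tail k%:R) @[k --> \oo] --> half_line set0.
  rewrite -capE; apply: nonincreasing_cvg_mu => //.
  - by rewrite capE; exact: measurable0.
  - move=> j k jk; apply/subsetPset => s; apply: le_lt_trans.
    by rewrite ler_nat.
have : t%:E <= half_line set0.
  rewrite -(cvg_lim _ cE)//; apply: lime_ge; first by apply/cvg_ex; eexists; exact: cE.
  by apply: nearW => k; exact: ltW.
by rewrite measure0 lee_fin leNgt t0.
Qed.

Variable Phi : R -> R.
Hypothesis hPhi : Orlicz_function Phi.

Let Orlicz_ext0 x : (forall t, Phi t = 0%R) -> Orlicz_ext Phi x = 0.
Proof.
move=> Phi0; have sup0 : ereal_sup (range (EFin \o Phi)) = 0.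
  rewrite (_ : range _ = [set 0]) ?ereal_sup1//.
  by apply/seteqP; split => [_ [t _ <-]|_ ->]; [|exists 0%R]; rewrite //= Phi0.
by case: x => //= r; rewrite Phi0.
Qed.

(** One level [u] serves both [Phi] on the reals and its extension: at infinity the supremum exceeds
    [s] because [Phi (u + 1)] does. *)
Let Orlicz_ext_superlevel s : (0 <= s)%R -> ~ (forall t, Phi t = 0%R) ->
  exists2 u, (0 <= u)%R & (forall v, (s < Phi v)%R = (u < `|v|)%R) /\
    forall x, 0 <= x -> (s%:E < Orlicz_ext Phi x) = (u%:E < x).
Proof.
move=> s0 /(Orlicz_superlevel hPhi s0)[u u0 uP]; exists u => //; split.
  by move=> v; rewrite -(Orlicz_norm hPhi) uP.
move=> [x| |] //=; first by rewrite !lee_fin !lte_fin; exact: uP.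
rewrite ltry; move=> _.
apply: (@lt_le_trans _ _ (Phi (u + 1))%:E).
  by rewrite lte_fin uP ?ltrDl// addr_ge0.
by apply: ereal_sup_ubound; exists (u + 1)%R.
Qed.

Let g t := Orlicz_ext Phi (rearrangement F t).

Let Orlicz_ext_ge0 x : 0 <= Orlicz_ext Phi x.
Proof.
case: x => [r| |] /=; first by rewrite lee_fin Orlicz_ge0.
  by apply: (@le_trans _ _ (Phi 0)%:E); [rewrite lee_fin Orlicz_ge0|apply: ereal_sup_ubound; exists 0%R].
by apply: (@le_trans _ _ (Phi 0)%:E); [rewrite lee_fin Orlicz_ge0|apply: ereal_sup_ubound; exists 0%R].
Qed.

Let measurable_g : measurable_fun setT (g : lebesgueType R -> \bar R).
Proof.
have [Phi0|Phi_neq0] := pselect (forall t, Phi t = 0%R).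
  rewrite [X in measurable_fun _ X](_ : _ = cst 0); first exact: measurable_cst.
  by apply/funext => t; rewrite /g Orlicz_ext0.
apply: (measurability _ (ErealGenOInfty.measurableE R)).
move=> _ [_ [r ->] <-]; rewrite setTI.
have [r0|r0] := ltP r 0%R.
  rewrite (_ : _ @^-1` _ = setT); first exact: measurableT.
  apply/seteqP; split => // t _ /=; rewrite in_itv/= andbT.
  by apply: lt_le_trans (Orlicz_ext_ge0 _); rewrite lte_fin.
have [u u0 [_ uP]] := Orlicz_ext_superlevel r0 Phi_neq0.
rewrite (_ : _ @^-1` _ = [set t | t%:E < half_line (tail u)]).
  have : is_interval [set t : R | t%:E < half_line (tail u)].
    move=> x y /= _ yt z /andP[_ zy]; apply: le_lt_trans yt.
    by rewrite lee_fin.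
  move=> /is_intervalP ->; exact: lebesgue_measurable_itv.
apply/seteqP; split => t /=; rewrite in_itv/= andbT /g uP ?rearrangement_ge0//;
  by rewrite lt_rearrangement.
Qed.

(** For each [s], with [u] the matching level of [Phi], the points of (0,1) where the integrand
    exceeds [s] form the interval from 0 to the smaller of 1 and the tail of [|F|] at [u].
    Restricting the rearrangement to (0,1) thus truncates the tail at 1. *)
Lemma integral_Orlicz_rearrangement :
  \int[unit_prob]_t g t =
  \int[lebesgue_measure]_(s in `[0%R, +oo[)
     mine 1 (half_line [set t | (s < Phi (F t))%R]).
Proof.
have [Phi0|Phi_neq0] := pselect (forall t, Phi t = 0%R).
  transitivity (0 : \bar R).
    by apply: integral0_eq => t _; rewrite /g Orlicz_ext0.
  apply/esym/integral0_eq => s sD.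
  have s0 : (0 <= s)%R by move: sD; rewrite /= in_itv/= andbT.
  suff -> : [set t | (s < Phi (F t))%R] = set0 by rewrite measure0 min_r.
  by apply/seteqP; split => // t /=; rewrite Phi0 ltNge s0.
(* The layer cake takes a real-valued function; [g] is finite at every [t > 0], which is all that
   the measure on (0,1) sees. *)
pose h t := fine (g t).
have mh : measurable_fun setT (h : lebesgueType R -> R).
  by apply: (@measurableT_comp _ _ _ _ _ _ fine) => //; exact: fine_measurable.
have h0 t : (0 <= h t)%R by exact/fine_ge0/Orlicz_ext_ge0.
have gE t : (0 < t)%R -> g t = (h t)%:E.
  move=> t0; rewrite /h /g; have := rearrangement_lty t0.
  by have := rearrangement_ge0 F t; case: (rearrangement F t).
rewrite integral_unit_prob//; last by move=> t; exact: Orlicz_ext_ge0.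
transitivity (\int[leb]_(t in `]0%R, 1%R[) (h t)%:E).
  apply: eq_integral => t; rewrite inE/= in_itv/= => /andP[t0 _]; exact: gE.
rewrite -integral_unit_prob; last 2 first.
- exact/measurable_EFinP.
- by move=> t; rewrite lee_fin.
transitivity (\int[unit_prob]_t ((h t)%:E * (cst 1 t))).
  by apply: eq_integral => t _; rewrite mule1.
rewrite layer_cake//.
apply: eq_integral => s; rewrite inE => sD.
have s0 : (0 <= s)%R by move: sD; rewrite /= in_itv/= andbT.
have [u u0 [uP uextP]] := Orlicz_ext_superlevel s0 Phi_neq0.
rewrite (_ : [set t | (s < Phi (F t))%R] = tail u); last first.
  by apply/seteqP; split => t /=; rewrite uP.
have tail_fin : half_line (tail u) \is a fin_num.
  by rewrite ge0_fin_numE// (le_lt_trans _ finF)//; exact: le_tail.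
pose A : set (lebesgueType R) := [set t | (s < h t)%R].
have mA : measurable A.
  have : measurable_fun setT (fun t : lebesgueType R => (s < h t)%R).
    exact: measurable_fun_ltr.
  by move=> /(_ measurableT [set true]); rewrite setTI; exact.
transitivity (unit_prob A).
  rewrite -[in RHS](setIT A) -integral_indic//.
  by apply: eq_integral => t _; rewrite mule1 indicE mem_setE.
rewrite /unit_prob/= /mrestr/=.
pose m := Num.min 1%R (fine (half_line (tail u))).
have m0 : (0 <= m)%R by rewrite le_min ler01 fine_ge0.
transitivity (@lebesgue_measure R `]0%R, m[%classic).
  congr (leb _); apply/seteqP; split => t /=; rewrite !in_itv/=.
    move=> [At /andP[t0 t1]]; rewrite t0/= lt_min t1/=.
    rewrite -lte_fin fineK// -lt_rearrangement// -uextP ?rearrangement_ge0//.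
    by rewrite -/(g t) gE.
  rewrite lt_min => /andP[t0 /andP[t1 tu]]; split; last by rewrite t0.
  rewrite /A/= -lte_fin -gE// /g uextP ?rearrangement_ge0// lt_rearrangement//.
  by rewrite -lte_fin fineK in tu.
rewrite lebesgue_measure_itv/= lte_fin.
have -> : mine 1 (half_line (tail u)) = m%:E.
  by rewrite /m EFin_min fineK.
by move: m0; rewrite le_eqVlt => /predU1P[<-|->]; rewrite ?ltxx ?sube0.
Qed.

End rearrangement.

(** * Tools for comparing integrals *)

Section monotone.
Local Open Scope ereal_scope.

(* The integral of a nonnegative function is a supremum over simple functions,
   so monotonicity needs no measurability. *)
Lemma ge0_le_integral_sup d (T : measurableType d) (R : realType)
    (mu : {measure set T -> \bar R}) (D : set T) (f g : T -> \bar R) :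
  (forall x, D x -> 0 <= f x) -> (forall x, D x -> f x <= g x) ->
  \int[mu]_(x in D) f x <= \int[mu]_(x in D) g x.
Proof.
move=> f0 fg; rewrite [leLHS]integral_mkcond [leRHS]integral_mkcond.
rewrite !ge0_integralTE; last 2 first.
- by apply: erestrict_ge0 => // x Dx; rewrite (le_trans (f0 _ Dx))// fg.
- exact: erestrict_ge0.
apply: ereal_sup_le => _ [h hf <-]; exists h => // x.
by apply: le_trans (hf x) _; exact: lee_restrict.
Qed.

Lemma nonincreasing_emeasurable (R : realType) (h : R -> \bar R) :
  {homo h : x y / (x <= y)%R >-> y <= x} ->
  measurable_fun setT (h : measurableTypeR R -> \bar R).
Proof.
move=> hh; apply: (measurability _ (ErealGenOInfty.measurableE R)).
move=> _ [_ [r ->] <-]; rewrite setTI; apply: is_interval_measurable.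
move=> x y /=; rewrite !in_itv/= !andbT => _ ry z /andP[_ zy].
by rewrite in_itv/= andbT (lt_le_trans ry)// hh.
Qed.

End monotone.

Section bool_indicator.
Context d (T : measurableType d) (R : realType).
Variable b : T -> bool.
Hypothesis mb : measurable [set t | b t].

Let natr_boolE : (fun t => (b t)%:R) = \1_[set t | b t] :> (T -> R).
Proof. by apply/funext => t; rewrite indicE mem_setE. Qed.

Lemma measurable_natr_bool : measurable_fun setT (fun t => (b t)%:R : R).
Proof. by rewrite natr_boolE; exact: measurable_indic. Qed.

Lemma integral_natr_bool (mu : {measure set T -> \bar R}) :
  (\int[mu]_t ((b t)%:R)%:E = mu [set t | b t])%E.
Proof.
rewrite -[in RHS](setIT [set t | b t]) -integral_indic//.
by apply: eq_integral => t _; rewrite -natr_boolE.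
Qed.

End bool_indicator.

Lemma layer_cake_scale d (T : measurableType d) (R : realType)
    (mu : {sigma_finite_measure set T -> \bar R}) (c : R) (g : T -> R) :
  0 <= c -> measurable_fun setT g -> (forall x, 0 <= g x) ->
  (c%:E * \int[mu]_x (g x)%:E =
   \int[lebesgue_measure]_(s in `[0%R, +oo[) (c%:E * mu [set x | (s < g x)%R]))%E.
Proof.
move=> c0 mg g0.
rewrite muleC -ge0_integralZr//; last 2 first.
- exact/measurable_EFinP.
- by move=> x _; rewrite lee_fin.
rewrite (layer_cake mu mg g0 (W := cst c%:E))//.
apply: eq_integral => s _.
have mA : measurable [set x | (s < g x)%R].
  have : measurable_fun setT (fun x => (s < g x)%R) by exact: measurable_fun_ltr.
  by move=> /(_ measurableT [set true]); rewrite setTI; exact.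
rewrite ge0_integralZr//=; last exact/measurable_EFinP/measurable_natr_bool.
by rewrite integral_natr_bool// muleC.
Qed.

(** * Tails of disjoint sums and integrals of rearrangements *)

Section tails.
Context (R : realType) (n : nat).
Variable f : 'I_n -> {RV (@unit_prob R) >-> measurableTypeR R}.
Local Open Scope ereal_scope.

Let F : lebesgueType R -> measurableTypeR R := disjoint_sum (fun k => f k : R -> R).
Let P : probability (lebesgueType R) R := unit_prob.

Lemma measurable_disjoint_sum_RV : measurable_fun setT F.
Proof. exact: measurable_disjoint_sum. Qed.

Let measurable_RV_preimage k (B : set (measurableTypeR R)) : measurable B ->
  measurable (f k @^-1` B).
Proof.
by move=> mB; rewrite -[X in measurable X]setTI; exact: measurable_funPT.
Qed.

(** Excluding 0 from [B] discards the region beyond [n], where the disjoint sum vanishes on a set of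
    infinite measure. *)
Lemma half_line_preimage (B : set (measurableTypeR R)) : measurable B -> ~ B 0%R ->
  half_line (F @^-1` B) = \sum_k P (f k @^-1` B).
Proof.
move=> mB B0.
have mFB : measurable (F @^-1` B).
  by rewrite -[X in measurable X]setTI; exact: measurable_disjoint_sum_RV.
rewrite -[F @^-1` B]setIT -integral_indic//.
transitivity (\int[half_line]_t (\1_B (F t))%:E); first by [].
rewrite (ge0_integral_disjoint_sum _ (measurable_indic mB))//.
  by apply: eq_bigr => k _; exact: integral_indic_preimage.
by rewrite indicE memNset.
Qed.

Lemma measurable_abs_gt (u : R) :
  measurable [set r : measurableTypeR R | (u < `|r|)%R].
Proof.
have : measurable_fun setT (fun r : measurableTypeR R => (u < `|r|)%R).
  by apply: measurable_fun_ltr => //; exact: normr_measurable.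
by move=> /(_ measurableT [set true]); rewrite setTI; exact.
Qed.

Lemma half_line_tail (u : R) : (0 <= u)%R ->
  half_line [set t | (u < `|F t|)%R] = \sum_k P [set t | (u < `|f k t|)%R].
Proof.
move=> u0; rewrite (half_line_preimage (measurable_abs_gt u))//=.
by rewrite normr0 ltNge u0.
Qed.

Lemma half_line_tail_lty (u : R) : (0 <= u)%R ->
  half_line [set t | (u < `|F t|)%R] < +oo.
Proof.
move=> u0; rewrite half_line_tail//; apply/lte_sum_pinfty => k _.
apply: (le_lt_trans (probability_le1 P _)); rewrite ?ltry//.
exact: (@measurable_RV_preimage k _ (measurable_abs_gt u)).
Qed.

Section with_Phi.
Variable Phi : R -> R.
Hypothesis hPhi : Orlicz_function Phi.

Let measurable_Phi_gt (s : R) :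
  measurable [set r : measurableTypeR R | (s < Phi r)%R].
Proof.
have : measurable_fun setT (fun r : measurableTypeR R => (s < Phi r)%R).
  by apply: measurable_fun_ltr => //; exact: measurable_Orlicz.
by move=> /(_ measurableT [set true]); rewrite setTI; exact.
Qed.

(** Superlevel sets of [Phi] are superlevel sets of the modulus, so a comparison of tails at every
    level [u] integrates to a comparison for [Phi] with the same constant. *)
Lemma integral_rearrangement_le_tail (c : R) (S : lebesgueType R -> R) :
  (0 <= c)%R -> measurable_fun setT S ->
  (forall u, (0 <= u)%R -> mine 1 (half_line [set t | (u < `|F t|)%R]) <=
     c%:E * P [set t | (u < `|S t|)%R]) ->
  \int[P]_t Orlicz_ext Phi (rearrangement F t) <= c%:E * \int[P]_t (Phi (S t))%:E.
Proof.
move=> c0 mS tail.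
have mPS : measurable_fun setT (fun t => Phi (S t)).
  by apply: measurableT_comp mS; exact: measurable_Orlicz.
rewrite (integral_Orlicz_rearrangement measurable_disjoint_sum_RV)//; last first.
  exact: half_line_tail_lty.
rewrite (layer_cake_scale P c0 mPS (fun t => Orlicz_ge0 hPhi _)).
apply: ge0_le_integral_sup => s sD.
  by rewrite le_min lee01/= measure_ge0.
have s0 : (0 <= s)%R by move: sD; rewrite /= in_itv/= andbT.
have [Phi0|Phi_neq0] := pselect (forall t, Phi t = 0%R).
  suff -> : [set t | (s < Phi (F t))%R] = set0 by rewrite measure0 min_r// mule_ge0.
  by apply/seteqP; split => // t /=; rewrite Phi0 ltNge s0.
have [u u0 uP] := Orlicz_superlevel hPhi s0 Phi_neq0.
have E (X : lebesgueType R -> R) :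
    [set t | (s < Phi (X t))%R] = [set t | (u < `|X t|)%R].
  by apply/seteqP; split => t /=; rewrite -(Orlicz_norm hPhi) uP.
by rewrite !E tail.
Qed.

(** At each level [s] the joint probabilities of [Phi (f k) > s] and [|f k| > u] sum to at most the
    tail at [u], which is at most 1, and to at most the tail of [Phi \o F] at [s]. Hence they are
    bounded by the minimum inside [integral_Orlicz_rearrangement]. *)
Lemma sum_above_le_integral_rearrangement (u : R) : (0 <= u)%R ->
  half_line [set t | (u < `|F t|)%R] <= 1 ->
  \sum_k \int[P]_t ((Phi (f k t))%:E * ((u < `|f k t|)%R%:R)%:E) <=
  \int[P]_t Orlicz_ext Phi (rearrangement F t).
Proof.
move=> u0 d1.
have mPf k : measurable_fun setT (fun t => Phi (f k t)).
  by apply: measurableT_comp => //; exact: measurable_Orlicz.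
have mA k : measurable [set t | (u < `|f k t|)%R].
  exact: (@measurable_RV_preimage k _ (measurable_abs_gt u)).
have mB s k : measurable [set t | (s < Phi (f k t))%R].
  exact: (@measurable_RV_preimage k _ (measurable_Phi_gt s)).
have mW k : measurable_fun setT (fun t => ((u < `|f k t|)%R%:R : R)%:E).
  exact/measurable_EFinP/measurable_natr_bool.
rewrite (integral_Orlicz_rearrangement measurable_disjoint_sum_RV)//; last first.
  exact: half_line_tail_lty.
under eq_bigr => k _.
  rewrite (layer_cake P (mPf k) (fun t => Orlicz_ge0 hPhi _) (mW k)); last first.
    by move=> t; rewrite lee_fin.
  over.
have E s k : \int[P]_t (((s < Phi (f k t))%R%:R)%:E * ((u < `|f k t|)%R%:R)%:E) =
    P ([set t | (s < Phi (f k t))%R] `&` [set t | (u < `|f k t|)%R]).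
  have E2 : [set t | (s < Phi (f k t))%R] `&` [set t | (u < `|f k t|)%R] =
      [set t | (s < Phi (f k t))%R && (u < `|f k t|)%R].
    by apply/seteqP; split => t /= /andP.
  rewrite E2 -integral_natr_bool//; last by rewrite -E2; exact: measurableI.
  by apply: eq_integral => t _; rewrite -EFinM -natrM mulnb.
rewrite -ge0_integral_sum//; last 2 first.
- move=> k; apply: measurable_funTS; apply: nonincreasing_emeasurable => x y xy.
  apply: ge0_le_integral_sup => t _; first by rewrite mule_ge0.
  rewrite lee_wpmul2r// lee_fin ler_nat.
  by case: (ltP y) => //= yP; rewrite (le_lt_trans xy).
- by move=> k s _; apply: integral_ge0 => t _; rewrite mule_ge0.
apply: ge0_le_integral_sup => s sD.
  by apply: sume_ge0 => k _; apply: integral_ge0 => t _; rewrite mule_ge0.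
have s0 : (0 <= s)%R by move: sD; rewrite /= in_itv/= andbT.
rewrite le_min; apply/andP; split.
  apply: le_trans d1; rewrite half_line_tail//; apply: lee_sum => k _.
  by rewrite E; apply: le_measure;
    [rewrite inE; exact: measurableI|rewrite inE; exact: mA|exact: subIsetr].
rewrite (half_line_preimage (measurable_Phi_gt s)); last first.
  by rewrite /= Orlicz0// ltNge s0.
apply: lee_sum => k _.
by rewrite E; apply: le_measure;
  [rewrite inE; exact: measurableI|rewrite inE; exact: mB|exact: subIsetl].
Qed.

End with_Phi.

End tails.

(** * Elementary inequalities and truncation *)

Section real_products.
Variable R : realType.

(** One factor at a time: (1 - p)(1 + p + s) <= 1 + s for p and s nonnegative. It is used for the
    tail of the maximum and again for the product of cosine means. *)
Lemma prod_1B_le (I : Type) (r : seq I) (p : I -> R) :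
  (forall i, 0 <= p i <= 1) ->
  (\prod_(i <- r) (1 - p i)) * (1 + \sum_(i <- r) p i) <= 1.
Proof.
move=> p01; elim: r => [|i r IH]; first by rewrite !big_nil addr0 mulr1.
rewrite !big_cons; have /andP[p0 p1] := p01 i.
have s0 : 0 <= \sum_(j <- r) p j by apply: sumr_ge0 => j _; case/andP: (p01 j).
have Q0 : 0 <= \prod_(j <- r) (1 - p j).
  by apply: prodr_ge0 => j _; rewrite subr_ge0; case/andP: (p01 j).
apply: le_trans IH; rewrite mulrAC mulrC ler_wpM2l//.
nra.
Qed.

Lemma prod_1D_le_expR (I : Type) (r : seq I) (q : I -> R) :
  (forall i, 0 <= q i) ->
  \prod_(i <- r) (1 + q i) <= expR (\sum_(i <- r) q i).
Proof.
move=> q0; elim: r => [|i r IH]; first by rewrite !big_nil expR0.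
rewrite !big_cons expRD ler_pM ?expR_ge1Dx//.
  by rewrite addr_ge0.
by apply: prodr_ge0 => j _; rewrite addr_ge0.
Qed.

Lemma half_addeK (x : \bar R) : (0 <= x)%E ->
  ((2^-1)%:E * x + (2^-1)%:E * x = x)%E.
Proof.
move=> x0; rewrite -ge0_muleDl// -EFinD.
have -> : (2^-1 + 2^-1 = 1 :> R)%R by field.
by rewrite mul1e.
Qed.

Lemma lee_prode (I : Type) (r : seq I) (x y : I -> \bar R) :
  (forall i, 0 <= x i)%E -> (forall i, x i <= y i)%E ->
  (\prod_(i <- r) x i <= \prod_(i <- r) y i)%E.
Proof.
move=> x0 xy; elim: r => [|i r IH]; first by rewrite !big_nil.
by rewrite !big_cons lee_pmul// prode_ge0.
Qed.

Lemma prode_EFin (I : Type) (r : seq I) (x : I -> R) :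
  (\prod_(i <- r) (x i)%:E)%E = (\prod_(i <- r) x i)%:E.
Proof.
by elim: r => [|i r IH]; rewrite ?big_nil// !big_cons IH EFinM.
Qed.

(** Passes through exp y <= 1/(1 - y). The linear term keeps its sign, so that it can cancel between
    [y] and [- y]. *)
Lemma expR_le_quadratic (y : R) : `|y| <= 2^-1 -> expR y <= 1 + y + 2 * y ^+ 2.
Proof.
move=> y2; have /andP[yl yu] : - 2^-1 <= y <= 2^-1 by rewrite -ler_norml.
have h : 0 < 1 - y by lra.
apply: (@le_trans _ _ (1 - y)^-1).
  rewrite -[expR y]invrK -expRN lef_pV2 ?posrE ?expR_gt0//.
  exact: expR_ge1Dx.
rewrite -[leLHS]mul1r ler_pdivrMr//.
have -> : (1 + y + 2 * y ^+ 2) * (1 - y) = 1 + y ^+ 2 * (1 - 2 * y) by ring.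
rewrite lerDl mulr_ge0 ?sqr_ge0//; lra.
Qed.

End real_products.

Section truncation.
Variable R : realType.
Implicit Types a r : R.

Definition below a r := r * (`|r| <= a)%R%:R.
Definition above a r := r * (a < `|r|)%R%:R.

Lemma belowDabove a r : below a r + above a r = r.
Proof.
by rewrite /below /above -mulrDr ltNge; case: (_ <= _); rewrite ?addr0 ?add0r mulr1.
Qed.

Lemma belowN a r : below a (- r) = - below a r.
Proof. by rewrite /below normrN mulNr. Qed.

Lemma normr_below a r : 0 <= a -> `|below a r| <= a.
Proof.
by move=> a0; rewrite /below; case: (leP (`|r|)%R a); rewrite ?mulr1// mulr0 normr0.
Qed.

Lemma normr_below_le a r : `|below a r| <= `|r|.
Proof. by rewrite /below normrM ler_piMr// ger0_norm// lern1 leq_b1. Qed.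

Lemma measurable_le_norm a :
  measurable [set r : measurableTypeR R | `|r| <= a].
Proof.
have : measurable_fun setT (fun r : measurableTypeR R => `|r| <= a).
  by apply: measurable_fun_ler => //; exact: normr_measurable.
by move=> /(_ measurableT [set true]); rewrite setTI; exact.
Qed.

Lemma measurable_below a :
  measurable_fun setT (below a : measurableTypeR R -> measurableTypeR R).
Proof.
apply: measurable_funM => //; apply: measurable_natr_bool.
exact: measurable_le_norm.
Qed.

Lemma measurable_above a :
  measurable_fun setT (above a : measurableTypeR R -> measurableTypeR R).
Proof.
apply: measurable_funM => //; apply: measurable_natr_bool.
exact: measurable_abs_gt.
Qed.

End truncation.

(** * Tail of the maximum of independent variables *)

Section independent_sums.
Context d (T : measurableType d) (R : realType) (P : probability T R).
Variables (n : nat) (X : 'I_n -> {RV P >-> measurableTypeR R}).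
Hypothesis indepX : independent_RVs X.
Local Open Scope ereal_scope.

Lemma measurable_RV_abs_gt k u : measurable [set x | (u < `|X k x|)%R].
Proof.
have h : measurable (X k @^-1` [set r | (u < `|r|)%R]).
  rewrite -[X in measurable X]setTI; apply: measurable_funPT => //.
  exact: measurable_abs_gt.
exact: h.
Qed.

Lemma measurable_max_abs_gt u : measurable [set x | exists k, (u < `|X k x|)%R].
Proof.
rewrite (_ : [set _ | _] = \bigcup_(k in [set: 'I_n]) [set x | (u < `|X k x|)%R]).
  by apply: fin_bigcup_measurable => // k _; exact: measurable_RV_abs_gt.
by apply/seteqP; split => x [k]; [exists k|exists k].
Qed.

(** Let [e] be the probability on the right and [s] the sum on the left. Independence gives 1 - e =
    prod (1 - p_k) <= 1/(1 + s), so e >= s/(1 + s) >= min(1, s)/2. *)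
Lemma tail_max_ge u :
  mine 1 (\sum_k P [set x | (u < `|X k x|)%R]) <=
  2%:E * P [set x | exists k, (u < `|X k x|)%R].
Proof.
pose p k := fine (P [set x | (u < `|X k x|)%R]).
have pE k : P [set x | (u < `|X k x|)%R] = (p k)%:E.
  by rewrite fineK// fin_num_measure//; exact: measurable_RV_abs_gt.
have p01 k : (0 <= p k <= 1)%R.
  rewrite -!lee_fin -pE measure_ge0 probability_le1//.
  exact: measurable_RV_abs_gt.
under eq_bigr do rewrite pE.
rewrite sumEFin.
have mex := measurable_max_abs_gt u.
pose e := fine (P [set x | exists k, (u < `|X k x|)%R]).
have eE : P [set x | exists k, (u < `|X k x|)%R] = e%:E.
  by rewrite fineK// fin_num_measure.
rewrite eE.
have : (1 - e = \prod_k (1 - p k))%R.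
  apply: EFin_inj; rewrite EFinB -eE -probability_setC// -prode_EFin.
  have -> : ~` [set x | exists k, (u < `|X k x|)%R] =
      \bigcap_(k in [set k | k \in [set: 'I_n]%SET])
        (X k @^-1` [set r | (`|r| <= u)%R]).
    apply/seteqP; split => [x /= /forallNP xu k _|x /= xu [k]].
      by rewrite /= leNgt; apply/negP/xu.
    by rewrite ltNge xu//= inE.
  rewrite indepX; last by move=> k; exact: measurable_le_norm.
  apply: eq_big => [k|k _]; first by rewrite inE.
  rewrite EFinB -pE -probability_setC//; last exact: measurable_RV_abs_gt.
  by congr (P _); apply/seteqP; split => x /=; rewrite leNgt => /negP.
have := prod_1B_le (index_enum 'I_n) p01.
set s := (\sum_k p k)%R; set Q := (\prod_k (1 - p k))%R => h eQ.
have s0 : (0 <= s)%R by apply: sumr_ge0 => k _; case/andP: (p01 k).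
rewrite -EFinM -EFin_min lee_fin ge_min.
apply/orP; have [s1|s1] := leP s 1%R; [right|left]; nra.
Qed.

Lemma integral_prod_le (h : 'I_n -> measurableTypeR R -> R) (q : 'I_n -> R) :
  (forall k, measurable_fun setT (h k)) -> (forall k r, 0 <= h k r)%R ->
  (forall k, 0 <= q k)%R ->
  (forall k, \int[P]_x (h k (X k x))%:E <= (1 + q k)%:E) ->
  \int[P]_x (\prod_k h k (X k x))%:E <= (expR (\sum_k q k))%:E.
Proof.
move=> mh h0 q0 hq; rewrite (expectation_prod indepX mh h0).
apply: (@le_trans _ _ (\prod_k (1 + q k)%:E)).
  by apply: lee_prode => // k; apply: integral_ge0 => x _; rewrite lee_fin.
by rewrite prode_EFin lee_fin prod_1D_le_expR.
Qed.

End independent_sums.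

(** * Upper bound at a fixed truncation level *)

Section upper_bound.
Context d (T : measurableType d) (R : realType) (P : probability T R).
Variables (n : nat) (X : 'I_n -> {RV P >-> measurableTypeR R}).
Hypothesis indepX : independent_RVs X.
Variables (Phi : R -> R) (K D a : R).
Hypothesis hPhi : Orlicz_function Phi.
Hypothesis D0 : 0 <= D.
Hypothesis PhiD : forall t, Phi (2 * t) <= D * Phi t.
Hypothesis K0 : 0 < K.
Hypothesis PhiK : forall t A, 0 <= t -> 0 <= A -> Phi (t * A) <= K * expR t * Phi A.
Hypothesis a0 : 0 < a.
Local Open Scope ereal_scope.

Let K_ge0 : (0 <= K)%R := ltW K0.

Let measurable_Phi_comp (Y : T -> R) : measurable_fun setT Y ->
  measurable_fun setT (fun x => (Phi (Y x))%:E).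
Proof.
move=> mY; apply/measurable_EFinP; apply: measurableT_comp mY.
exact: measurable_Orlicz.
Qed.

Let measurable_comp_X k (h : measurableTypeR R -> R) : measurable_fun setT h ->
  measurable_fun setT (fun x => h (X k x)).
Proof. by move=> mh; exact: measurableT_comp. Qed.

(** The scale [2 * a] brings each truncated variable into [-1/2, 1/2], the range of
    [expR_le_quadratic]; it costs one factor [D], from [Phi (2 * a) <= D * Phi a]. *)
Lemma integral_sum_below_le (q : 'I_n -> R) :
  (forall k, 0 <= q k)%R ->
  (forall k, \int[P]_x (expR (below a (X k x) / (2 * a)))%:E <= (1 + q k)%:E) ->
  (forall k, \int[P]_x (expR (- (below a (X k x) / (2 * a))))%:E <= (1 + q k)%:E) ->
  \int[P]_x (Phi (\sum_k below a (X k x)))%:E <=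
  (K * D * 2 * expR (\sum_k q k) * Phi a)%:E.
Proof.
move=> q0 hq hqN.
pose y (r : measurableTypeR R) : R := (below a r / (2 * a))%R.
have my : measurable_fun setT y.
  by apply: measurable_funM => //; exact: measurable_below.
pose E (c : R) x := (\prod_k expR (c * y (X k x)))%R.
have mE c : measurable_fun setT (E c).
  apply: measurable_prod => k _.
  apply: (measurable_comp_X k (h := fun r => expR (c * y r))).
  by apply: measurableT_comp => //; exact: measurable_funM.
have EE c x : E c x = expR (c * (\sum_k y (X k x))).
  by rewrite /E mulr_sumr expR_sum.
have E0 c x : (0 <= E c x)%R by rewrite EE expR_ge0.
have iE c : (forall k, \int[P]_x (expR (c * y (X k x)))%:E <= (1 + q k)%:E) ->
    \int[P]_x (E c x)%:E <= (expR (\sum_k q k))%:E.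
  move=> h; apply: (integral_prod_le indepX (h := fun k r => expR (c * y r))) => //.
  by move=> k; apply: measurableT_comp => //; exact: measurable_funM.
clearbody E.
pose c0 := (K * D * Phi a)%R.
have c00 : (0 <= c0)%R by rewrite !mulr_ge0 ?(Orlicz_ge0 hPhi).
(* The exponential of [|s|] does not factorise over [k]; it is at most the sum of those of [s] and
   [- s], which do. Hence the factor 2. *)
apply: (@le_trans _ _ (\int[P]_x (c0%:E * ((E 1 x)%:E + (E (-1) x)%:E)))).
  apply: ge0_le_integral_sup => x _; first by rewrite lee_fin Orlicz_ge0.
  rewrite -EFinD -EFinM lee_fin.
  set s := (\sum_k y (X k x))%R.
  have -> : (\sum_k below a (X k x) = s * (2 * a))%R.
    by rewrite /s mulr_suml; apply: eq_bigr => k _; rewrite /y divfK// mulf_neq0// gt_eqF.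
  rewrite -(Orlicz_norm hPhi) normrM (gtr0_norm (x := 2 * a)) ?mulr_gt0//.
  apply: le_trans (PhiK (normr_ge0 s) _) _; first by rewrite mulr_ge0// ltW.
  apply: (@le_trans _ _ (K * expR `|s| * (D * Phi a))%R).
    by rewrite ler_wpM2l ?PhiD// mulr_ge0 ?expR_ge0// ltW.
  have -> : (K * expR `|s| * (D * Phi a) = c0 * expR `|s|)%R by rewrite /c0; ring.
  rewrite ler_wpM2l// !EE mul1r mulN1r.
  by case: (ger0P s) => _; rewrite ?lerDl ?lerDr expR_ge0.
rewrite ge0_integralZl//; last 2 first.
- apply: emeasurable_funD; exact/measurable_EFinP.
- by move=> x _; rewrite adde_ge0// lee_fin.
rewrite ge0_integralD//; last 4 first.
- by move=> x _; rewrite lee_fin.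
- exact/measurable_EFinP.
- by move=> x _; rewrite lee_fin.
- exact/measurable_EFinP.
have -> : (K * D * 2 * expR (\sum_k q k) * Phi a)%:E =
    c0%:E * ((expR (\sum_k q k))%:E + (expR (\sum_k q k))%:E).
  by rewrite -EFinD -EFinM /c0; congr (_%:E); ring.
apply: lee_wpmul2l; first by rewrite lee_fin.
apply: leeD; apply: iE => k.
- under eq_integral do rewrite mul1r.
  exact: hq.
- under eq_integral do rewrite mulN1r.
  exact: hqN.
Qed.

Let num x : R := \sum_k (a < `|X k x|)%R%:R.

(** With [j] the index of largest modulus, the sum is at most [num x * |X j x|] in modulus, and the
    growth bound turns the factor [num x] into [expR (num x)]. Summing over all [j] removes the
    dependence of that index on [x]. *)
Let Orlicz_sum_above x :
  (Phi (\sum_k above a (X k x)) <=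
   K * \sum_j Phi (X j x) * (a < `|X j x|)%R%:R * expR (num x))%R.
Proof.
have num0 : (0 <= num x)%R by apply: sumr_ge0.
have term0 j : (0 <= Phi (X j x) * (a < `|X j x|)%R%:R * expR (num x))%R.
  by rewrite !mulr_ge0 ?(Orlicz_ge0 hPhi) ?expR_ge0.
have [[i ai]|none] := pselect (exists i, a < `|X i x|)%R; last first.
  rewrite big1 ?(Orlicz0 hPhi)//; first by rewrite mulr_ge0 ?(ltW K0)// sumr_ge0.
  move=> k _; rewrite /above; case: (boolP (a < _)%R) => ak; last by rewrite mulr0.
  by exfalso; apply: none; exists k.
case: (@arg_maxP _ R 'I_n i (fun k => (a < `|X k x|)%R) (fun k => `|X k x|)%R ai).
move=> j aj jmax.
apply: (@le_trans _ _ (Phi (num x * `|X j x|))%R).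
  apply: (Orlicz_homo_norm hPhi).
  rewrite [leRHS]ger0_norm ?mulr_ge0// mulr_suml.
  apply: le_trans (ler_norm_sum _ _ _) _; apply: ler_sum => k _.
  rewrite /above normrM normr_nat mulrC.
  case: (boolP (a < _)%R) => ak; last by rewrite !mul0r.
  by rewrite !mul1r; exact: jmax.
apply: le_trans (PhiK num0 (normr_ge0 _)) _.
rewrite (Orlicz_norm hPhi) -mulrA ler_wpM2l ?(ltW K0)//.
rewrite (bigD1 j)//= aj mulr1 mulrC lerDl; exact: sumr_ge0.
Qed.

(** The exponential of [num] is a product over [k]. In the j-th summand, factor [j] contributes e
    times the integral on the right. Any other factor has mean at most 1 + e p_k, and as the p_k sum
    to at most 1 these multiply to at most exp(e). *)
Lemma integral_sum_above_le :
  \sum_k P [set x | (a < `|X k x|)%R] <= 1 ->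
  \int[P]_x (Phi (\sum_k above a (X k x)))%:E <=
  (K * expR 1 * expR (expR 1))%:E *
    \sum_k \int[P]_x ((Phi (X k x))%:E * ((a < `|X k x|)%R%:R)%:E).
Proof.
move=> d1.
pose b k x : R := ((a < `|X k x|)%R%:R)%R.
have mb : measurable_fun setT (fun r : measurableTypeR R => ((a < `|r|)%R%:R : R)).
  by apply: measurable_natr_bool; exact: measurable_abs_gt.
pose h (j k : 'I_n) (r : measurableTypeR R) : R :=
  ((if k == j then Phi r * (a < `|r|)%R%:R else 1) * expR ((a < `|r|)%R%:R))%R.
have mh j k : measurable_fun setT (h j k).
  rewrite /h; apply: measurable_funM; last exact: measurableT_comp mb.
  by case: (k == j) => //; apply: measurable_funM => //; exact: measurable_Orlicz.
have h0 j k r : (0 <= h j k r)%R.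
  by rewrite /h mulr_ge0 ?expR_ge0//; case: ifP => // _; rewrite mulr_ge0 ?(Orlicz_ge0 hPhi).
have hE j x : (Phi (X j x) * (a < `|X j x|)%R%:R * expR (num x) =
    \prod_k h j k (X k x))%R.
  rewrite /h big_split/= -expR_sum (bigD1 j)//= eqxx big1 ?mulr1// => k /negbTE ->.
  by [].
have mprod j : measurable_fun setT (fun x => (\prod_k h j k (X k x))%:E).
  by apply/measurable_EFinP; apply: measurable_prod => k _; exact: measurable_comp_X.
apply: (@le_trans _ _ (\int[P]_x (K%:E * \sum_j (\prod_k h j k (X k x))%:E))).
  apply: ge0_le_integral_sup => x _; first by rewrite lee_fin Orlicz_ge0.
  rewrite sumEFin -EFinM lee_fin.
  by rewrite -(eq_bigr _ (fun j _ => hE j x)); exact: Orlicz_sum_above.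
rewrite ge0_integralZl//; last 2 first.
- exact: emeasurable_sum.
- by move=> x _; apply: sume_ge0 => j _; rewrite lee_fin prodr_ge0.
rewrite ge0_integral_sum//; last by move=> j x _; rewrite lee_fin prodr_ge0.
rewrite -!mulrA EFinM -muleA lee_wpmul2l ?lee_fin ?(ltW K0)//.
have p_fin k : P [set x | (a < `|X k x|)%R] \is a fin_num.
  by rewrite fin_num_measure//; exact: measurable_RV_abs_gt.
pose p k := fine (P [set x | (a < `|X k x|)%R]).
have sp : (\sum_k p k <= 1)%R.
  by rewrite -lee_fin -sumEFin; under eq_bigr do rewrite fineK//.
have e0 : (0 <= expR 1 :> R)%R by exact: expR_ge0.
pose I j := \int[P]_x ((Phi (X j x))%:E * ((a < `|X j x|)%R%:R)%:E).
have I0 j : 0 <= I j.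
  by apply: integral_ge0 => x _; rewrite mule_ge0// lee_fin Orlicz_ge0.
rewrite EFinM ge0_sume_distrr; last by move=> j _; exact: I0.
apply: lee_sum => j _.
rewrite (expectation_prod indepX (mh j) (h0 j)) (bigD1 j)//=.
have hj : \int[P]_x (h j j (X j x))%:E <= (expR 1)%:E * I j.
  rewrite /I -ge0_integralZl//; last 2 first.
  - apply: emeasurable_funM.
      exact: (measurable_Phi_comp (@measurable_funPT _ _ _ _ (X j))).
    by apply/measurable_EFinP; exact: (measurable_comp_X j mb).
  - by move=> x _; rewrite mule_ge0// lee_fin Orlicz_ge0.
  apply: ge0_le_integral_sup => x _; first by rewrite lee_fin.
  rewrite -!EFinM lee_fin /h eqxx; case: (a < _)%R; rewrite ?mulr0 ?mul0r ?mulr1//.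
  by rewrite mulrC.
have hk : \prod_(k | k != j) \int[P]_x (h j k (X k x))%:E <= (expR (expR 1))%:E.
  apply: (@le_trans _ _ (\prod_k (1 + expR 1 * p k)%:E)).
    rewrite big_mkcond/=; apply: lee_prode => k.
      by case: ifP => // _; apply: integral_ge0 => x _; rewrite lee_fin.
    case: ifPn => [kj|_]; last by rewrite lee_fin lerDl mulr_ge0// fine_ge0.
    apply: (@le_trans _ _ (\int[P]_x (1 + (expR 1)%:E * (b k x)%:E))).
      apply: ge0_le_integral_sup => x _; first by rewrite lee_fin.
      rewrite -EFinM -EFinD lee_fin /h (negbTE kj) mul1r /b.
      by case: (a < _)%R; rewrite ?mulr1 ?mulr0 ?expR0 ?addr0// lerDr.
    have mbk : measurable_fun setT (fun x => (b k x)%:E).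
      by apply/measurable_EFinP; exact: (measurable_comp_X k mb).
    rewrite ge0_integralD//; last 2 first.
    - by move=> x _; rewrite mule_ge0// lee_fin.
    - exact: measurable_funeM.
    rewrite ge0_integralZl//; last by move=> x _; rewrite lee_fin.
    have -> : \int[P]_x 1 = 1 by rewrite integral_cst// mul1e; exact: probability_setT.
    rewrite /b integral_natr_bool; last first.
      exact: measurable_RV_abs_gt.
    by rewrite EFinD EFinM fineK.
  rewrite prode_EFin lee_fin.
  apply: le_trans (prod_1D_le_expR _ _) _; first by move=> k; rewrite mulr_ge0// fine_ge0.
  by rewrite ler_expR -mulr_sumr ler_piMr.
apply: le_trans (lee_pmul _ _ hj hk) _.
- by apply: integral_ge0 => x _; rewrite lee_fin.
- by apply: prode_ge0 => k _; apply: integral_ge0 => x _; rewrite lee_fin.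
by rewrite muleAC.
Qed.

Lemma integral_Orlicz_sum_le (q : 'I_n -> R) :
  (forall k, 0 <= q k)%R ->
  (forall k, \int[P]_x (expR (below a (X k x) / (2 * a)))%:E <= (1 + q k)%:E) ->
  (forall k, \int[P]_x (expR (- (below a (X k x) / (2 * a))))%:E <= (1 + q k)%:E) ->
  \sum_k P [set x | (a < `|X k x|)%R] <= 1 ->
  \int[P]_x (Phi (\sum_k X k x))%:E <=
  (D * (K * D * 2 * expR (\sum_k q k)))%:E * (Phi a)%:E +
  (D * (K * expR 1 * expR (expR 1)))%:E *
    \sum_k \int[P]_x ((Phi (X k x))%:E * ((a < `|X k x|)%R%:R)%:E).
Proof.
move=> q0 hq hqN d1.
have mbelow : measurable_fun setT (fun x => (Phi (\sum_k below a (X k x)))%:E).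
  apply: measurable_Phi_comp; apply: measurable_sum => k.
  by apply: measurable_comp_X; exact: measurable_below.
have mabove : measurable_fun setT (fun x => (Phi (\sum_k above a (X k x)))%:E).
  apply: measurable_Phi_comp; apply: measurable_sum => k.
  by apply: measurable_comp_X; exact: measurable_above.
apply: (@le_trans _ _ (\int[P]_x (D%:E * ((Phi (\sum_k below a (X k x)))%:E +
    (Phi (\sum_k above a (X k x)))%:E)))).
  apply: ge0_le_integral_sup => x _; first by rewrite lee_fin Orlicz_ge0.
  rewrite -EFinD -EFinM lee_fin.
  under eq_bigr do rewrite -(belowDabove a (X _ x)).
  by rewrite big_split; exact: Orlicz_splitD.
rewrite ge0_integralZl//; last 2 first.
- exact: emeasurable_funD.
- by move=> x _; rewrite adde_ge0// lee_fin Orlicz_ge0.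
rewrite ge0_integralD//; last 2 first.
- by move=> x _; rewrite lee_fin Orlicz_ge0.
- by move=> x _; rewrite lee_fin Orlicz_ge0.
rewrite ge0_muleDr; last 2 first.
- by apply: integral_ge0 => x _; rewrite lee_fin Orlicz_ge0.
- by apply: integral_ge0 => x _; rewrite lee_fin Orlicz_ge0.
apply: leeD.
- rewrite EFinM -muleA; apply: lee_wpmul2l; first by rewrite lee_fin.
  by rewrite -EFinM; exact: integral_sum_below_le.
- rewrite EFinM -muleA; apply: lee_wpmul2l; first by rewrite lee_fin.
  exact: integral_sum_above_le.
Qed.

End upper_bound.

(** * Symmetric variables: sign changes and the maximum *)

Section first_passage.
Variables (R : realType) (n : nat).

(** The sum telescopes along partial products. For 0/1 values the k-th summand indicates that [k] is
    the first index where [a] vanishes. *)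
Lemma sum_first_failure (a : 'I_n -> R) :
  \sum_(k < n) (\prod_(j < n | (j < k)%N) a j) * (1 - a k) = 1 - \prod_j a j.
Proof.
pose A (i : nat) := \prod_(j < n | (j < i)%N) a j.
have AS (k : 'I_n) : A k.+1 = a k * A k.
  rewrite /A (bigD1 k)//=; congr (_ * _); apply: eq_bigl => j.
  by rewrite ltnS -(inj_eq val_inj) ltn_neqAle andbC.
rewrite (eq_bigr (fun k : 'I_n => - (A k.+1 - A k))); last first.
  by move=> k _; rewrite AS opprB mulrBr mulr1 mulrC.
rewrite sumrN -(big_mkord xpredT (fun k => A k.+1 - A k)) /=.
rewrite telescope_sumr// opprB; congr (_ - _).
  by rewrite /A big_pred0.
by apply: eq_bigl => j; rewrite ltn_ord.
Qed.

End first_passage.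

Section symmetric.
Context d (T : measurableType d) (R : realType) (P : probability T R).
Variables (n : nat) (X : 'I_n -> {RV P >-> measurableTypeR R}).
Hypothesis indepX : independent_RVs X.
Hypothesis symX : forall k, symmetric_RV (X k).
Local Open Scope ereal_scope.
Local Notation jointType := (g_sigma_algebraType (@rectangles R n)).

Lemma integral_flip (sigma : 'I_n -> bool) (G : jointType -> \bar R) :
  measurable_fun setT G -> (forall v, 0 <= G v) ->
  \int[P]_x G (fun k => if sigma k then (- X k x)%R else X k x) =
  \int[P]_x G (fun k => X k x).
Proof.
move=> mG G0.
pose tau k (r : measurableTypeR R) : measurableTypeR R :=
  if sigma k then (- r)%R else r.
apply: (joint_law_invariant indepX (tau := tau)) => //.
- by move=> k; rewrite /tau; case: (sigma k) => //; exact: measurable_funN.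
- by move=> k B mB; rewrite /tau; case: (sigma k) => //; rewrite [RHS]symX.
Qed.

Lemma measurable_joint_sum (h : measurableTypeR R -> R) : measurable_fun setT h ->
  measurable_fun setT ((fun v => \sum_k h (v k))%R : jointType -> R).
Proof.
move=> mh; apply: measurable_sum => k.
by apply: measurableT_comp mh _; exact: measurable_coord.
Qed.

(* Levy's inequality: if [k] is the first index with [u < `|X k|], flipping the
   signs of all other variables preserves that event, and
   [2 * X k] is the sum of the two versions of the total sum. *)
Lemma tail_max_le_sum (u : R) :
  P [set x | exists k, (u < `|X k x|)%R] <=
  2%:E * P [set x | (u < `|\sum_k X k x|)%R].
Proof.
have mle : measurable_fun setT (fun r : measurableTypeR R => ((`|r| <= u)%R%:R : R)).
  by apply: measurable_natr_bool; exact: measurable_le_norm.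
have mgt : measurable_fun setT (fun r : measurableTypeR R => ((u < `|r|)%R%:R : R)).
  by apply: measurable_natr_bool; exact: measurable_abs_gt.
pose b (k : 'I_n) (v : jointType) : R :=
  ((\prod_(j < n | (j < k)%N) (`|v j| <= u)%R%:R) * (u < `|v k|)%R%:R)%R.
have mb k : measurable_fun setT (b k).
  apply: measurable_funM.
    rewrite [X in measurable_fun _ X](_ : _ = fun v : jointType =>
        (\prod_(j < n) if (j < k)%N then (`|v j| <= u)%R%:R else 1)%R).
      apply: measurable_prod => j _; case: (j < k)%N => //.
      by apply: measurableT_comp mle _; exact: measurable_coord.
    by apply/funext => v; rewrite big_mkcond.
  by apply: measurableT_comp mgt _; exact: measurable_coord.
have b0 k v : (0 <= b k v)%R by rewrite mulr_ge0 ?prodr_ge0.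
have bE v : (\sum_k b k v = 1 - \prod_j (`|v j| <= u)%R%:R)%R.
  rewrite -sum_first_failure; apply: eq_bigr => k _; congr (_ * _)%R.
  by rewrite ltNge; case: (_ <= _)%R; rewrite ?subrr ?subr0.
pose sgt (v : jointType) : R := ((u < `|\sum_k v k|)%R%:R)%R.
have msgt : measurable_fun setT sgt.
  by apply: measurableT_comp mgt _; exact: (@measurable_joint_sum id).
pose flip (k : 'I_n) (v : 'I_n -> R) : 'I_n -> R :=
  fun j => if j != k then (- v j)%R else v j.
have bflip k v : b k (flip k v) = b k v.
  rewrite /b /flip eqxx; congr (_ * _)%R; apply: eq_bigr => j jk.
  by case: ifP => // _; rewrite normrN.
(* If both sums had modulus at most [u], then [|2 * v k| <= 2 * u], which contradicts
   [|v k| > u]. *)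
have key k v : (b k v <= b k v * sgt v + b k (flip k v) * sgt (flip k v))%R.
  have [vk|vk] := leP `|v k|%R u.
    have bk0 : b k v = 0%R by rewrite /b ltNge vk mulr0.
    by rewrite bflip bk0 !mul0r addr0.
  rewrite bflip -mulrDr ler_peMr// /sgt.
  have sumE : (\sum_j v j + \sum_j flip k v j = 2 * v k)%R.
    rewrite -big_split/= (bigD1 k)//= /flip eqxx big1 ?addr0 ?mulr2n ?mulrDl ?mul1r//.
    by move=> j jk; rewrite jk subrr.
  have [s1|s1] := ltP u `|\sum_j v j|%R; first by rewrite lerDl.
  have [s2|s2] := ltP u `|\sum_j flip k v j|%R; first by rewrite lerDr.
  exfalso; move: vk; rewrite ltNge => /negP; apply.
  have : (`|2 * v k| <= u + u)%R by rewrite -sumE (le_trans (ler_normD _ _))// lerD.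
  by rewrite normrM ger0_norm// mulr2n mulrDl mul1r; lra.
have mX : measurable_fun setT ((fun x k => X k x) : T -> jointType).
  by apply: measurable_joint => k.
have mbX k : measurable_fun setT (fun x => b k (fun k => X k x)).
  exact: (measurableT_comp (mb k) mX).
have msX : measurable_fun setT (fun x => sgt (fun k => X k x)).
  exact: (measurableT_comp msgt mX).
pose Y k x : 'I_n -> R := flip k (fun j => X j x).
have mbs k : measurable_fun setT (fun v : jointType => (b k v * sgt v)%:E).
  by apply/measurable_EFinP; exact: measurable_funM.
have mflip k : measurable_fun setT (Y k : T -> jointType).
  apply: (measurable_joint (X := fun j x => if j != k then (- X j x)%R else X j x)).
  move=> j; case: (j != k); last exact: measurable_funPT.
  exact: (measurable_funN (@measurable_funPT _ _ _ _ (X j))).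
have bs0 k v : 0 <= (b k v * sgt v)%:E by rewrite lee_fin mulr_ge0.
have mex : measurable [set x | (u < `|\sum_k X k x|)%R].
  apply: measurable_norm_gt; apply: measurable_sum => k.
  exact: (@measurable_funPT _ _ _ _ (X k)).
rewrite -(integral_natr_bool mex).
have maxE : [set x | exists k, (u < `|X k x|)%R] =
    [set x | `[< exists k, (u < `|X k x|)%R >]].
  by apply/seteqP; split => x /asboolP.
have mmax := measurable_max_abs_gt X u.
rewrite maxE in mmax *.
rewrite -(integral_natr_bool mmax).
apply: (@le_trans _ _ (\int[P]_x \sum_k ((b k (X ^~ x) * sgt (X ^~ x))%:E +
    (b k (Y k x) * sgt (Y k x))%:E))).
  apply: ge0_le_integral_sup => x _; first by rewrite lee_fin.
  apply: (@le_trans _ _ (\sum_k (b k (X ^~ x))%:E)); last first.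
    by apply: lee_sum => k _; rewrite -EFinD lee_fin; exact: key.
  rewrite sumEFin lee_fin bE; case: asboolP => [[k uk]|_]/=.
    have /negbTE uk' : ~~ (`|X k x| <= u)%R by rewrite -ltNge.
    by rewrite (bigD1 k)//= uk' mul0r subr0.
  by rewrite subr_ge0 prodr_ile1// => j _; rewrite ler0n lern1 leq_b1.
rewrite ge0_integral_sum//; last 2 first.
- move=> k; apply: emeasurable_funD; first exact: (measurableT_comp (mbs k) mX).
  exact: (measurableT_comp (mbs k) (mflip k)).
- by move=> k x _; rewrite adde_ge0.
have twice k : \int[P]_x ((b k (X ^~ x) * sgt (X ^~ x))%:E +
    (b k (Y k x) * sgt (Y k x))%:E) =
    2%:E * \int[P]_x (b k (X ^~ x) * sgt (X ^~ x))%:E.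
  rewrite ge0_integralD//; last 2 first.
  - exact: (measurableT_comp (mbs k) mX).
  - exact: (measurableT_comp (mbs k) (mflip k)).
  rewrite (integral_flip (fun j => j != k) (mbs k) (bs0 k)).
  by rewrite -[RHS]/(_ * _) mule_natl mule2n.
rewrite (eq_bigr _ (fun k _ => twice k)) -ge0_sume_distrr; last first.
  by move=> k _; apply: integral_ge0 => x _; exact: bs0.
apply: lee_wpmul2l => //.
rewrite -ge0_integral_sum//; last first.
  by move=> k; exact: (measurableT_comp (mbs k) mX).
apply: ge0_le_integral_sup => x _; first by apply: sume_ge0 => k _.
rewrite sumEFin lee_fin -mulr_suml ler_piMl// bE lerBlDr lerDl prodr_ge0//.
Qed.

End symmetric.

(** * Cosine inequalities *)

Section cosine_bounds.
Variable R : realType.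
Implicit Types x y : R.

Let sin_mvt x : 0 < x -> exists2 c, 0 < c < x & sin x = cos c * x.
Proof.
move=> x0.
have cont : {within `[0, x], continuous (@sin R)}.
  by apply: continuous_subspaceT => t; exact: continuous_sin.
have [c cx] := MVT x0 (fun t _ => is_derive_sin t) cont.
by rewrite sin0 !subr0 => ->; exists c => //; move: cx; rewrite in_itv.
Qed.

Lemma normr_sin_le x : `|sin x| <= `|x|.
Proof.
wlog x0 : x / 0 < x => [h|].
  have [x0|x0|->] := ltgtP x 0; last by rewrite sin0.
    by have := h (- x); rewrite sinN !normrN oppr_gt0; exact.
  exact: h.
have [c _ ->] := sin_mvt x0.
by rewrite normrM ler_piMl// cos_max.
Qed.

Lemma oneBcosE x : 1 - cos x = 2 * sin (x / 2) ^+ 2.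
Proof.
have -> : cos x = cos (x / 2 + x / 2) by congr cos; field.
by rewrite cosD -!expr2 cos2sin2; ring.
Qed.

(** In the square of sin(x/2) one factor is bounded by 1 and the other by |x|/2. A linear bound is
    wanted because only a first moment of the sum is available. *)
Lemma oneBcos_le x : 1 - cos x <= `|x|.
Proof.
rewrite oneBcosE; have := normr_sin_le (x / 2).
rewrite normrM (ger0_norm (x := 2^-1))// => sx.
rewrite -(real_normK (num_real (sin _))) expr2.
have := sin_max (x / 2); have := normr_ge0 (sin (x / 2)); have := normr_ge0 x.
nra.
Qed.

Lemma cos_ge0_le1 x : `|x| <= 1 -> 0 <= cos x.
Proof. by move=> x1; have := oneBcos_le x; lra. Qed.

(** By the mean value theorem sin(x/2) is cos c times x/2 with c below 1/2, so cos c >= 1/2 and 2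
    sin^2(x/2) >= 2 (x/4)^2 = x^2/8. *)
Lemma cos_le_quadratic x : `|x| <= 1 -> cos x + x ^+ 2 / 8 <= 1.
Proof.
move=> x1; suff : x ^+ 2 / 8 <= 1 - cos x by lra.
wlog x0 : x x1 / 0 < x => [h|].
  have [x0|x0|->] := ltgtP x 0; last by rewrite cos0 expr0n/= mul0r subrr.
    by have := h (- x); rewrite cosN sqrrN normrN oppr_gt0; exact.
  exact: h.
rewrite oneBcosE.
have x20 : 0 < x / 2 by rewrite divr_gt0.
have [c /andP[c0 cx] ->] := sin_mvt x20.
move: x1; rewrite gtr0_norm// => x1.
have : 1 - c <= cos c by have := oneBcos_le c; rewrite gtr0_norm//; lra.
move=> cc; have c2 : 2^-1 <= cos c by lra.
rewrite exprMn.
have : (2^-1) ^+ 2 <= cos c ^+ 2 by rewrite lerXn2r ?nnegrE//; lra.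
have : 0 <= x ^+ 2 by exact: sqr_ge0.
rewrite exprMn; nra.
Qed.

End cosine_bounds.

(** * Truncation and cosines of symmetric sums *)

Section symmetric_moments.
Context d (T : measurableType d) (R : realType) (P : probability T R).
Variables (n : nat) (X : 'I_n -> {RV P >-> measurableTypeR R}).
Hypothesis indepX : independent_RVs X.
Hypothesis symX : forall k, symmetric_RV (X k).
Local Open Scope ereal_scope.
Local Notation jointType := (g_sigma_algebraType (@rectangles R n)).

Let mX : measurable_fun setT ((fun x k => X k x) : T -> jointType).
Proof. by apply: measurable_joint => k. Qed.

(** The map changes signs only on the set of [r] with [|r| > a], which is itself symmetric.
    Splitting [B] along that set reduces the claim to the symmetry of [X k]. *)
Lemma reflect_above_law (a : R) k (B : set (measurableTypeR R)) : measurable B ->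
  P ((fun x => (below a (X k x) - above a (X k x))%R) @^-1` B) = P (X k @^-1` B).
Proof.
move=> mB.
pose I : set (measurableTypeR R) := [set r | (`|r| <= a)%R].
pose O : set (measurableTypeR R) := [set r | (a < `|r|)%R].
have mI : measurable I by exact: measurable_le_norm.
have mO : measurable O by exact: measurable_abs_gt.
have mN : measurable ((fun r : measurableTypeR R => (- r)%R : measurableTypeR R) @^-1` B).
  rewrite -[X in measurable X]setTI.
  exact: (measurable_funN (@measurable_id _ (measurableTypeR R) setT) measurableT).
have mXpre C : measurable C -> measurable (X k @^-1` C).
  by move=> mC; rewrite -[X in measurable X]setTI; exact: measurable_funPT.
pose N : set (measurableTypeR R) := [set r | B (- r)%R].
have split_IO (C : set (measurableTypeR R)) : measurable C ->
    P (X k @^-1` C) = P (X k @^-1` (I `&` C)) + P (X k @^-1` (O `&` C)).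
  move=> mC; rewrite -measureU//; last 3 first.
  - by apply: mXpre; exact: measurableI.
  - by apply: mXpre; exact: measurableI.
  - by apply/seteqP; split => // x [[/= Ix _] [/= Ox _]]; move: Ox; rewrite /O/= ltNge Ix.
  congr (P _); apply/seteqP; split => x /=; last by case=> -[].
  by move=> Cx; have [xa|xa] := leP `|X k x|%R a; [left|right].
rewrite (split_IO B mB).
have -> : (fun x => (below a (X k x) - above a (X k x))%R) @^-1` B =
    (X k @^-1` (I `&` B)) `|` (X k @^-1` (O `&` N)).
  apply/seteqP; split => x /=; rewrite /below /above /I /O /N/=.
    by have [xa|xa] := leP `|X k x|%R a; rewrite ?mulr1 ?mulr0 ?subr0 ?sub0r; [left|right].
  move=> [[xa]|[xa]]; first by rewrite xa ltNge xa/= mulr1 mulr0 subr0.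
  by rewrite xa leNgt xa/= mulr1 mulr0 sub0r.
rewrite measureU//; last 3 first.
- by apply: mXpre; exact: measurableI.
- by apply: mXpre; exact: measurableI.
- by apply/seteqP; split => // x [[/= Ix _] [/= Ox _]]; move: Ox; rewrite /O/= ltNge Ix.
congr (_ + _); rewrite [RHS]symX; last exact: measurableI.
by congr (P _); apply/seteqP; split => x; rewrite /= /O/= normrN.
Qed.

(* Truncation is half the sum of the identity and of the reflection of the
   large values, and both leave the joint law unchanged. *)
Lemma integral_norm_below_le (a : R) :
  \int[P]_x (`|\sum_k below a (X k x)|%R)%:E <= \int[P]_x (`|\sum_k X k x|%R)%:E.
Proof.
pose tau (r : measurableTypeR R) : measurableTypeR R := (below a r - above a r)%R.
have mtau : measurable_fun setT tau.
  by apply: measurable_funB; [exact: measurable_below|exact: measurable_above].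
pose G (v : jointType) : \bar R := (`|\sum_k v k|%R)%:E.
have mG : measurable_fun setT G.
  apply/measurable_EFinP; apply: (measurableT_comp (@normr_measurable R setT)).
  exact: (@measurable_joint_sum _ _ id).
have G0 v : 0 <= G v by rewrite lee_fin.
have Etau : \int[P]_x G (fun k => tau (X k x)) = \int[P]_x G (fun k => X k x).
  apply: (joint_law_invariant indepX (tau := fun=> tau)) => // k B mB.
  exact: reflect_above_law.
have mtauX : measurable_fun setT ((fun x k => tau (X k x)) : T -> jointType).
  apply: (measurable_joint (X := fun k x => tau (X k x))) => k.
  exact: measurableT_comp.
rewrite -[leRHS]half_addeK; last by apply: integral_ge0 => x _; exact: G0.
rewrite -[X in _ <= _ + _ * X]Etau.
rewrite -!ge0_integralZl//; last 2 first.
- exact: (measurableT_comp mG mtauX).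
- exact: (measurableT_comp mG mX).
rewrite -ge0_integralD//; last 3 first.
- by apply: measurable_funeM; exact: (measurableT_comp mG mX).
- by move=> x _; rewrite mule_ge0.
- by apply: measurable_funeM; exact: (measurableT_comp mG mtauX).
apply: ge0_le_integral_sup => x _; first by rewrite lee_fin.
rewrite /G -!EFinM -EFinD lee_fin -mulrDr.
have -> : (\sum_k below a (X k x) = 2^-1 * (\sum_k X k x + \sum_k tau (X k x)))%R.
  rewrite -big_split/= mulr_sumr; apply: eq_bigr => k _.
  by rewrite /tau -{2}(belowDabove a (X k x)); field.
rewrite normrM ger0_norm// ler_wpM2l//; exact: ler_normD.
Qed.

Section cosine.
Variable c : R -> R.
Hypothesis mc : measurable_fun setT (c : measurableTypeR R -> R).
Hypothesis cN : forall r, (c (- r) = - c r)%R.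

(** Interpolates between the two integrands of [integral_cos_sum]: the first [j] variables already
    enter through a product of cosines, the others still through the cosine of their sum.
    Subtracting from 1 makes it nonnegative. *)
Let D (j : nat) (v : jointType) : R :=
  (1 - (\prod_(k < n | (k < j)%N) cos (c (v k))) *
       cos (\sum_(k < n | (j <= k)%N) c (v k)))%R.

Let D_ge0 j v : (0 <= D j v)%R.
Proof.
rewrite subr_ge0; apply: le_trans (ler_norm _) _; rewrite normrM normr_prod.
rewrite mulr_ile1 ?normr_ge0 ?cos_max ?prodr_ge0// prodr_ile1// => k _.
by rewrite normr_ge0 cos_max.
Qed.

Let measurable_D j : measurable_fun setT (D j).
Proof.
have mcv k : measurable_fun setT ((fun v => c (v k)) : jointType -> R).
  by apply: measurableT_comp mc _; exact: measurable_coord.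
have mcos : measurable_fun setT (@cos R).
  by apply: continuous_measurable_fun => t; exact: continuous_cos.
apply: measurable_funB => //; apply: measurable_funM.
  rewrite [X in measurable_fun _ X](_ : _ = fun v : jointType =>
      (\prod_(k < n) if (k < j)%N then cos (c (v k)) else 1)%R).
    apply: measurable_prod => k _; case: (k < j)%N => //.
    exact: (measurableT_comp mcos (mcv k)).
  by apply/funext => v; rewrite big_mkcond.
apply: (measurableT_comp mcos).
rewrite [X in measurable_fun _ X](_ : _ = fun v : jointType =>
    (\sum_(k < n) if (j <= k)%N then c (v k) else 0)%R).
  by apply: measurable_sum => k; case: (j <= k)%N.
by apply/funext => v; rewrite big_mkcond.
Qed.

Let D_flip (i : 'I_n) (v : 'I_n -> R) :
  (D i.+1 v = 2^-1 * D i v +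
    2^-1 * D i (fun k => if k == i then - v k else v k))%R.
Proof.
have prodS w : (\prod_(k < n | (k < i.+1)%N) cos (c (w k)) =
    cos (c (w i)) * \prod_(k < n | (k < i)%N) cos (c (w k)))%R.
  rewrite (bigD1 i)//=; congr (_ * _)%R; apply: eq_bigl => k.
  by rewrite ltnS -(inj_eq val_inj) ltn_neqAle andbC.
have sumS w : (\sum_(k < n | (i <= k)%N) c (w k) =
    c (w i) + \sum_(k < n | (i.+1 <= k)%N) c (w k))%R.
  rewrite (bigD1 i)//=; congr (_ + _)%R; apply: eq_bigl => k.
  by rewrite -(inj_eq val_inj) ltn_neqAle andbC eq_sym.
rewrite /D prodS !sumS eqxx cN.
set p := (\prod_(k < n | (k < i)%N) cos (c (v k)))%R.
set s := (\sum_(k < n | (i.+1 <= k)%N) c (v k))%R.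
have -> : (\prod_(k < n | (k < i)%N) cos (c (if k == i then - v k else v k)) = p)%R.
  by apply: eq_bigr => k ki; rewrite ifF//; apply/negbTE; rewrite -(inj_eq val_inj) ltn_eqF.
have -> : (\sum_(k < n | (i.+1 <= k)%N) c (if k == i then - v k else v k) = s)%R.
  by apply: eq_bigr => k ki; rewrite ifF//; apply/negbTE; rewrite -(inj_eq val_inj) gtn_eqF.
by rewrite !cosD cosN sinN; field.
Qed.

(* Averaging over the sign of one more variable turns [cos (y + s)] into
   [cos y * cos s]. *)
Lemma integral_cos_sum :
  \int[P]_x (1 - cos (\sum_k c (X k x)))%:E =
  \int[P]_x (1 - \prod_k cos (c (X k x)))%:E.
Proof.
have mDX j : measurable_fun setT (fun x => (D j (X ^~ x))%:E).
  by apply/measurable_EFinP; exact: (measurableT_comp (measurable_D j) mX).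
have step (i : 'I_n) :
    \int[P]_x (D i.+1 (X ^~ x))%:E = \int[P]_x (D i (X ^~ x))%:E.
  pose Y (x : T) : jointType := fun k => if k == i then (- X k x)%R else X k x.
  have mY : measurable_fun setT Y.
    apply: (measurable_joint (X := fun k x => if k == i then (- X k x)%R else X k x)).
    move=> k; case: (k == i); last exact: measurable_funPT.
    exact: (measurable_funN (@measurable_funPT _ _ _ _ (X k))).
  have mDY : measurable_fun setT (fun x => (D i (Y x))%:E).
    by apply/measurable_EFinP; exact: (measurableT_comp (measurable_D i) mY).
  have EY : \int[P]_x (D i (Y x))%:E = \int[P]_x (D i (X ^~ x))%:E.
    apply: (integral_flip indepX symX (fun k => k == i) (G := EFin \o D i)).
      by apply/measurable_EFinP; exact: measurable_D.
    by move=> v; rewrite lee_fin.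
  rewrite -[RHS]half_addeK; last by apply: integral_ge0 => x _; rewrite lee_fin.
  rewrite -[X in _ = _ + _ * X]EY -!ge0_integralZl//; last 2 first.
  - by move=> x _; rewrite lee_fin.
  - by move=> x _; rewrite lee_fin.
  rewrite -ge0_integralD//; last 4 first.
  - by move=> x _; rewrite mule_ge0// lee_fin.
  - exact: measurable_funeM.
  - by move=> x _; rewrite mule_ge0// lee_fin.
  - exact: measurable_funeM.
  by apply: eq_integral => x _; rewrite D_flip.
have all_steps j : (j <= n)%N ->
    \int[P]_x (D j (X ^~ x))%:E = \int[P]_x (D 0 (X ^~ x))%:E.
  elim: j => // j IH jn; rewrite -(IH (ltnW jn)).
  exact: (step (Ordinal jn)).
transitivity (\int[P]_x (D 0 (X ^~ x))%:E).
  apply: eq_integral => x _; congr (1 - _)%:E.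
  by rewrite [X in (X * _)%R]big_pred0// mul1r.
rewrite -(all_steps n (leqnn n)); apply: eq_integral => x _; congr (1 - _)%:E.
rewrite [X in cos X]big_pred0 ?cos0 ?mulr1; last by move=> k; rewrite leqNgt ltn_ord.
by apply: eq_bigl => k; rewrite ltn_ord.
Qed.

End cosine.

End symmetric_moments.

(** * Exponential and second moments of truncated variables *)

Section moment_bounds.
Context d (T : measurableType d) (R : realType) (P : probability T R).
Variables (n : nat) (X : 'I_n -> {RV P >-> measurableTypeR R}).
Local Open Scope ereal_scope.

Let measurable_comp_X k (h : measurableTypeR R -> R) : measurable_fun setT h ->
  measurable_fun setT (fun x => (h (X k x))%:E).
Proof. by move=> mh; apply/measurable_EFinP; exact: measurableT_comp. Qed.

Let integral_cst1 : \int[P]_x 1 = 1.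
Proof. by rewrite integral_cst// mul1e; exact: probability_setT. Qed.

Lemma markov_abs (Y : T -> R) (a : R) : (0 < a)%R -> measurable_fun setT Y ->
  a%:E * P [set x | (a < `|Y x|)%R] <= \int[P]_x (`|Y x|%R)%:E.
Proof.
move=> a0 mY.
have mA := measurable_norm_gt a mY.
rewrite -integral_natr_bool// -ge0_integralZl//; last 2 first.
- exact/measurable_EFinP/measurable_natr_bool.
- by rewrite lee_fin ltW.
apply: ge0_le_integral_sup => x _; first by rewrite mule_ge0// lee_fin ltW.
rewrite -EFinM lee_fin; case: ltP => [/ltW|_]; first by rewrite mulr1.
by rewrite mulr0.
Qed.

(** For |y| <= 1/2 both y and 2 y^2 are at most |y|, and 2|y| is the truncated modulus divided by
    [a]. The boolean [s] selects the sign of the exponent. *)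
Lemma integral_exp_below_le (a : R) k (s : bool) : (0 < a)%R ->
  \int[P]_x (expR ((-1) ^+ s * (below a (X k x) / (2 * a))))%:E <=
  1 + \int[P]_x (`|below a (X k x)| / a)%:E.
Proof.
move=> a0.
have mb : measurable_fun setT (fun r : measurableTypeR R => (`|below a r| / a)%R : R).
  apply: measurable_funM => //.
  by apply: (measurableT_comp (@normr_measurable R setT)); exact: measurable_below.
rewrite -{1}integral_cst1 -ge0_integralD//; last 2 first.
- by move=> x _; rewrite lee_fin divr_ge0// ltW.
- exact: (measurable_comp_X k mb).
apply: ge0_le_integral_sup => x _; first by rewrite lee_fin expR_ge0.
rewrite -EFinD lee_fin.
set y := ((-1) ^+ s * _)%R.
have yE : (`|y| = `|below a (X k x)| / a / 2)%R.
  rewrite /y normrM normr_sign mul1r normrM normfV (gtr0_norm (x := 2 * a)) ?mulr_gt0//.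
  by field; rewrite gt_eqF.
have y2 : (`|y| <= 2^-1)%R.
  rewrite yE ler_pdivrMr// mulVf// ler_pdivrMr// mul1r.
  by apply: normr_below; exact: ltW.
apply: le_trans (expR_le_quadratic y2) _.
have -> : (`|below a (X k x)| / a = 2 * `|y|)%R by rewrite yE; field; rewrite gt_eqF.
rewrite -(real_normK (num_real y)); have := ler_norm y; have := normr_ge0 y.
nra.
Qed.

Lemma integral_norm_below_scale_le (a : R) k : (0 < a)%R ->
  a%:E * \int[P]_x (`|below a (X k x)| / a)%:E <= \int[P]_x (`|X k x|%R)%:E.
Proof.
move=> a0.
have mb : measurable_fun setT (fun r : measurableTypeR R => (`|below a r| / a)%R : R).
  apply: measurable_funM => //.
  by apply: (measurableT_comp (@normr_measurable R setT)); exact: measurable_below.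
rewrite -ge0_integralZl//; last 3 first.
- exact: (measurable_comp_X k mb).
- by move=> x _; rewrite lee_fin divr_ge0// ltW.
- by rewrite lee_fin ltW.
apply: ge0_le_integral_sup => x _.
  by rewrite -EFinM lee_fin mulrC divfK// gt_eqF.
by rewrite -EFinM lee_fin mulrC divfK ?gt_eqF// normr_below_le.
Qed.

Lemma integral_sq_below_scale (a : R) k :
  \int[P]_x ((below a (X k x)) ^+ 2 / (2 * a ^+ 2))%:E =
  ((2 * a ^+ 2)^-1)%:E * \int[P]_x ((below a (X k x)) ^+ 2)%:E.
Proof.
rewrite -ge0_integralZl//; last 3 first.
- apply: (measurable_comp_X k (h := fun r => below a r ^+ 2)%R).
  by apply: measurable_funX; exact: measurable_below.
- by move=> x _; rewrite lee_fin sqr_ge0.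
- by rewrite lee_fin invr_ge0 mulr_ge0// sqr_ge0.
by apply: eq_integral => x _; rewrite -EFinM mulrC.
Qed.

Hypothesis indepX : independent_RVs X.
Hypothesis symX : forall k, symmetric_RV (X k).

(** By symmetry the integral equals its average over both signs of the exponent, in which the linear
    terms cancel; what remains is twice the square. *)
Lemma integral_exp_below_sym_le (a : R) k (s : bool) : (0 < a)%R ->
  \int[P]_x (expR ((-1) ^+ s * (below a (X k x) / (2 * a))))%:E <=
  1 + \int[P]_x ((below a (X k x)) ^+ 2 / (2 * a ^+ 2))%:E.
Proof.
move=> a0.
pose y (r : measurableTypeR R) : R := (below a r / (2 * a))%R.
have my : measurable_fun setT y.
  by apply: measurable_funM => //; exact: measurable_below.
have me (t : bool) : measurable_fun setT (fun r => expR ((-1) ^+ t * y r)).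
  by apply: measurableT_comp => //; exact: measurable_funM.
have flip (t : bool) : \int[P]_x (expR ((-1) ^+ (~~ t) * y (X k x)))%:E =
    \int[P]_x (expR ((-1) ^+ t * y (X k x)))%:E.
  pose G (v : g_sigma_algebraType (@rectangles R n)) : \bar R :=
    (expR ((-1) ^+ t * y (v k)))%:E.
  transitivity (\int[P]_x G (fun j => if j == k then (- X j x)%R else X j x)).
    apply: eq_integral => x _; rewrite /G eqxx /y belowN mulNr mulrN.
    by congr (expR _)%:E; case: (t) => /=; rewrite ?expr0 ?expr1; ring.
  apply: (integral_flip indepX symX (fun j => j == k) (G := G)).
    apply/measurable_EFinP; apply: (measurableT_comp (me t)); exact: measurable_coord.
  by move=> v; rewrite lee_fin expR_ge0.
have mb : measurable_fun setT
    (fun r : measurableTypeR R => ((below a r) ^+ 2 / (2 * a ^+ 2))%R : R).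
  apply: measurable_funM => //; apply: measurable_funX; exact: measurable_below.
have b0 x : (0 <= (below a (X k x)) ^+ 2 / (2 * a ^+ 2))%R.
  by rewrite divr_ge0 ?sqr_ge0// mulr_ge0// sqr_ge0.
rewrite -/(y _).
rewrite -[leLHS]half_addeK; last by apply: integral_ge0 => x _; rewrite lee_fin expR_ge0.
rewrite -[X in _ + _ * X <= _]flip.
rewrite -!ge0_integralZl//; last 2 first.
- exact: (measurable_comp_X k (me _)).
- exact: (measurable_comp_X k (me _)).
rewrite -ge0_integralD//; last 2 first.
- by apply: measurable_funeM; exact: (measurable_comp_X k (me _)).
- by apply: measurable_funeM; exact: (measurable_comp_X k (me _)).
rewrite -{1}integral_cst1 -ge0_integralD//; last 2 first.
- by move=> x _; rewrite lee_fin.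
- exact: (measurable_comp_X k mb).
apply: ge0_le_integral_sup => x _.
  by rewrite adde_ge0// mule_ge0// lee_fin expR_ge0.
rewrite -!EFinM -!EFinD lee_fin.
set z := y (X k x).
have z2 : (`|z| <= 2^-1)%R.
  rewrite /z /y normrM normfV (gtr0_norm (x := 2 * a)) ?mulr_gt0//.
  rewrite ler_pdivrMr ?mulr_gt0// mulrA mulVf// mul1r.
  by apply: normr_below; exact: ltW.
have e1 := expR_le_quadratic z2.
have e2 : (expR (- z) <= 1 - z + 2 * z ^+ 2)%R.
  by have := @expR_le_quadratic _ (- z); rewrite normrN sqrrN; exact.
have -> : ((below a (X k x)) ^+ 2 / (2 * a ^+ 2) = 2 * z ^+ 2)%R.
  by rewrite /z /y; field; rewrite gt_eqF.
by case: s => /=; rewrite ?expr0 ?expr1 ?mul1r ?mulN1r; lra.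
Qed.

(** With [a = 5 * m] the mean of 1 - cos of the scaled truncated sum is at most m/a = 1/5, so the
    cosine means multiply to at least 4/5. Each is at most 1 - q_k, where q_k is the mean of c^2/8.
    Then [prod_1B_le] gives (4/5)(1 + sum q_k) <= 1, so sum q_k <= 1/4, and rescaling by 8 a^2
    yields 2 a^2. *)
Lemma second_moment_below (m : R) : (0 < m)%R ->
  \int[P]_x (`|\sum_k X k x|%R)%:E <= m%:E ->
  \sum_k \int[P]_x ((below (5 * m) (X k x)) ^+ 2)%:E <= (2 * (5 * m) ^+ 2)%:E.
Proof.
move=> m0 Sm; set a := (5 * m)%R.
have a0 : (0 < a)%R by rewrite mulr_gt0.
pose c (r : R) : R := (below a r / a)%R.
have mc : measurable_fun setT (c : measurableTypeR R -> R).
  by apply: measurable_funM => //; exact: measurable_below.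
have cN r : c (- r)%R = (- c r)%R by rewrite /c belowN mulNr.
have c1 r : (`|c r| <= 1)%R.
  rewrite /c normrM normfV (gtr0_norm a0) ler_pdivrMr// mul1r.
  by apply: normr_below; exact: ltW.
have mcos : measurable_fun setT (fun r : measurableTypeR R => cos (c r)).
  apply: (@measurableT_comp _ _ _ _ _ _ (@cos R)) mc.
  by apply: continuous_measurable_fun => t; exact: continuous_cos.
have cos0 r : (0 <= cos (c r))%R by apply: cos_ge0_le1.
have cprod1 x : (0 <= 1 - \prod_k cos (c (X k x)))%R.
  by rewrite subr_ge0 prodr_ile1// => k _; rewrite cos0 cos_le1.
have H1 : \int[P]_x (1 - \prod_k cos (c (X k x)))%:E <= (5^-1)%:E.
  rewrite -(integral_cos_sum indepX symX mc cN).
  apply: (@le_trans _ _ (\int[P]_x ((a^-1)%:E * (`|\sum_k below a (X k x)|%R)%:E))).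
    apply: ge0_le_integral_sup => x _; first by rewrite lee_fin subr_ge0 cos_le1.
    rewrite -EFinM lee_fin; apply: le_trans (oneBcos_le _) _.
    by rewrite /c -mulr_suml normrM normfV (gtr0_norm a0) mulrC.
  rewrite ge0_integralZl//; last 2 first.
  - apply/measurable_EFinP; apply: (measurableT_comp (@normr_measurable R setT)).
    apply: measurable_sum => k; apply: measurableT_comp; first exact: measurable_below.
    exact: measurable_funPT.
  - by rewrite lee_fin invr_ge0 ltW.
  have -> : (5^-1)%:E = (a^-1)%:E * m%:E.
    by rewrite -EFinM /a; congr (_%:E); field; rewrite gt_eqF.
  apply: lee_wpmul2l; first by rewrite lee_fin invr_ge0 ltW.
  exact: le_trans (integral_norm_below_le indepX symX a) Sm.
have mprod : measurable_fun setT (fun x => \prod_k cos (c (X k x)))%R.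
  apply: measurable_prod => k _; exact: (measurableT_comp mcos (@measurable_funPT _ _ _ _ (X k))).
have H2 : \int[P]_x (1 - \prod_k cos (c (X k x)))%:E +
    \prod_k \int[P]_x (cos (c (X k x)))%:E = 1.
  rewrite -(expectation_prod indepX (h := fun=> cos \o c))//.
  rewrite -ge0_integralD//; last 4 first.
  - by move=> x _; rewrite lee_fin.
  - by apply/measurable_EFinP; exact: measurable_funB.
  - by move=> x _; rewrite lee_fin prodr_ge0// => k _; exact: cos0.
  - exact/measurable_EFinP.
  by rewrite -[RHS]integral_cst1; apply: eq_integral => x _; rewrite -EFinD subrK.
pose Q k := \int[P]_x ((c (X k x)) ^+ 2 / 8)%:E.
have mQ : measurable_fun setT (fun r : measurableTypeR R => ((c r) ^+ 2 / 8)%R : R).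
  by apply: measurable_funM => //; exact: measurable_funX.
have Qe0 r : (0 <= (c r) ^+ 2 / 8)%R by rewrite divr_ge0 ?sqr_ge0.
have Q0 k : 0 <= Q k by apply: integral_ge0 => x _; rewrite lee_fin.
have H3 k : \int[P]_x (cos (c (X k x)))%:E + Q k <= 1.
  rewrite -ge0_integralD//; last 4 first.
  - by move=> x _; rewrite lee_fin.
  - exact: (measurable_comp_X k mcos).
  - by move=> x _; rewrite lee_fin.
  - exact: (measurable_comp_X k mQ).
  rewrite -[leRHS]integral_cst1; apply: ge0_le_integral_sup => x _.
    by rewrite adde_ge0// lee_fin.
  by rewrite -EFinD lee_fin cos_le_quadratic.
have W0 k : 0 <= \int[P]_x (cos (c (X k x)))%:E.
  by apply: integral_ge0 => x _; rewrite lee_fin.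
pose w k := fine (\int[P]_x (cos (c (X k x)))%:E).
pose q k := fine (Q k).
have wE k : \int[P]_x (cos (c (X k x)))%:E = (w k)%:E.
  rewrite fineK// ge0_fin_numE//; apply: le_lt_trans (ltry 1).
  by apply: le_trans (H3 k); rewrite leeDl.
have qE k : Q k = (q k)%:E.
  rewrite fineK// ge0_fin_numE//; apply: le_lt_trans (ltry 1).
  by apply: le_trans (H3 k); rewrite leeDr.
have w0 k : (0 <= w k)%R by rewrite fine_ge0.
have wq k : (w k + q k <= 1)%R by rewrite -lee_fin EFinD -wE -qE.
have q01 k : (0 <= q k <= 1)%R.
  by rewrite fine_ge0//=; have := wq k; have := w0 k; lra.
have prodw : (4 / 5 <= \prod_k w k)%R.
  rewrite -lee_fin -prode_EFin; under eq_bigr do rewrite -wE.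
  have I1fin : \int[P]_x (1 - \prod_k cos (c (X k x)))%:E \is a fin_num.
    rewrite ge0_fin_numE; first exact: le_lt_trans H1 (ltry _).
    by apply: integral_ge0 => x _; rewrite lee_fin.
  have -> : (\prod_k \int[P]_x (cos (c (X k x)))%:E)%E =
      1 - \int[P]_x (1 - \prod_k cos (c (X k x)))%:E.
    by rewrite -[X in X - _]H2 addeAC subee// add0e.
  have -> : (4 / 5)%:E = 1 - (5^-1)%:E :> \bar R.
    by rewrite -EFinB; congr (_%:E); field.
  exact: leeB.
have sumq : (\sum_k q k <= 4^-1)%R.
  have := prod_1B_le (index_enum 'I_n) q01.
  have : (\prod_k w k <= \prod_k (1 - q k))%R.
    by apply: ler_prod => k _; rewrite w0/=; have := wq k; lra.
  have : (0 <= \sum_k q k)%R by apply: sumr_ge0 => k _; case/andP: (q01 k).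
  move: prodw; set w' := (\prod_k w k)%R; set q' := (\prod_k (1 - q k))%R.
  set s := (\sum_k q k)%R; move=> h1 h2 h3 h4; nra.
have E8 k : \int[P]_x ((below a (X k x)) ^+ 2)%:E = (8 * a ^+ 2 * q k)%:E.
  rewrite EFinM -qE /Q -ge0_integralZl//; last 3 first.
  - exact: (measurable_comp_X k mQ).
  - by move=> x _; rewrite lee_fin.
  - by rewrite lee_fin mulr_ge0// sqr_ge0.
  apply: eq_integral => x _; rewrite -EFinM /c; congr (_%:E).
  by field; rewrite gt_eqF.
under eq_bigr do rewrite E8.
rewrite sumEFin lee_fin -mulr_sumr.
have : (0 <= a ^+ 2)%R by exact: sqr_ge0.
nra.
Qed.

End moment_bounds.

(** * [Phi] at a norm, from real levels and from means *)

Section Orlicz_limits.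
Variables (R : realType) (Phi : R -> R) (K D : R).
Hypothesis hPhi : Orlicz_function Phi.
Hypothesis D0 : 0 <= D.
Hypothesis PhiD : forall t, Phi (2 * t) <= D * Phi t.
Hypothesis K0 : 0 < K.
Hypothesis PhiK : forall t A, 0 <= t -> 0 <= A -> Phi (t * A) <= K * expR t * Phi A.
Hypothesis Phi_neq0 : ~ (forall t, Phi t = 0).
Local Open Scope ereal_scope.

Lemma Orlicz_ext_ge0 x : 0 <= Orlicz_ext Phi x.
Proof.
have sup0 : 0 <= ereal_sup (range (EFin \o Phi)).
  by apply: ereal_sup_ubound; exists 0%R => //=; rewrite Orlicz0.
by case: x => [r| |] //=; rewrite lee_fin Orlicz_ge0.
Qed.

Lemma Orlicz_exty : Orlicz_ext Phi +oo = +oo.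
Proof.
apply/eqyP => r r0 /=.
have [u u0 uP] := Orlicz_superlevel hPhi (ltW r0) Phi_neq0.
apply: (@le_trans _ _ (Phi (u + 1))%:E).
  by rewrite lee_fin ltW// uP ?ltrDl// addr_ge0.
by apply: ereal_sup_ubound; exists (u + 1)%R.
Qed.

(** For finite positive [x] the level [A = 2 * x] costs one factor [D]. At [x = 0] the level tends
    to 0, and for [x] infinite the right side is infinite, which is why [c * D] must be positive. *)
Lemma le_Orlicz_ext_from_above (c : R) (x Z W : \bar R) :
  (0 <= c)%R -> (0 < c * D)%R -> 0 <= x -> 0 <= W ->
  (forall A : R, (0 < A)%R -> x < A%:E -> Z <= c%:E * (Phi A)%:E + W) ->
  Z <= (c * D)%:E * Orlicz_ext Phi x + W.
Proof.
move=> c0 cD0 x0 W0 H.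
case: x x0 H => [x| |]// x0 H; last first.
  by rewrite Orlicz_exty gt0_muley ?lte_fin// addye ?leey// gt_eqF// (lt_le_trans _ W0).
have [x_gt0|x_le0] := ltP 0%R x.
  apply: (@le_trans _ _ (c%:E * (Phi (2 * x))%:E + W)).
    by apply: H; [rewrite mulr_gt0|rewrite lte_fin; lra].
  rewrite leeD2r// -!EFinM lee_fin -mulrA ler_wpM2l//.
have {x0 x_le0} x0 : x = 0%R by apply/eqP; rewrite eq_le x_le0 -lee_fin.
rewrite x0 /= Orlicz0// mule0 add0e; apply/lee_addgt0Pr => e e0.
have P1 : (0 < c * Phi 1 + 1)%R by rewrite ltr_wpDl// mulr_ge0// Orlicz_ge0.
(* For [A <= 1] convexity gives [Phi A <= A * Phi 1], so this choice makes [c * Phi A] at most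
   [e]. *)
pose A := (Num.min 1 (e / (c * Phi 1 + 1)))%R.
have A0 : (0 < A)%R by rewrite lt_min ltr01 divr_gt0.
have A1 : (A <= 1)%R by rewrite ge_min lexx.
have Ae : (A * (c * Phi 1 + 1) <= e)%R.
  by rewrite -ler_pdivlMr// ge_min lexx orbT.
apply: le_trans (H A A0 _) _; first by rewrite x0 lte_fin.
rewrite addeC leeD2l// -EFinM lee_fin.
have PA : (Phi A <= A * Phi 1)%R.
  by have := Orlicz_star hPhi 1 (ltW A0) A1; rewrite mulr1.
have : (c * Phi A <= c * (A * Phi 1))%R by rewrite ler_wpM2l.
nra.
Qed.

Context d (T : measurableType d) (P : probability T R).
Variable V : T -> R.
Hypothesis mV : measurable_fun setT V.

Let mPhiV : measurable_fun setT (fun x => (Phi (V x))%:E).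
Proof.
by apply/measurable_EFinP; apply: measurableT_comp mV; exact: measurable_Orlicz.
Qed.

Let IPhi0 : 0 <= \int[P]_x (Phi (V x))%:E.
Proof. by apply: integral_ge0 => x _; rewrite lee_fin Orlicz_ge0. Qed.

(* A chord replaces Jensen's inequality at the price of the factor 2: by
   convexity [Phi t >= (Phi a / a) (t - a)] for [t >= 0]. *)
Lemma Orlicz_half_mean_le (a : R) : (0 < a)%R ->
  (2 * a)%:E <= \int[P]_x (`|V x|%R)%:E -> (Phi a)%:E <= \int[P]_x (Phi (V x))%:E.
Proof.
move=> a0 aV; move: (Orlicz_ge0 hPhi a); rewrite le_eqVlt => /predU1P[<-//|Pa0].
have : (2 * a)%:E <= a%:E + (a / Phi a)%:E * \int[P]_x (Phi (V x))%:E.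
  apply: le_trans aV _.
  rewrite -ge0_integralZl//; last 2 first.
  - by move=> x _; rewrite lee_fin Orlicz_ge0.
  - by rewrite lee_fin divr_ge0// ltW.
  have -> : a%:E = \int[P]_x a%:E.
    by rewrite integral_cst// [X in _ * X]probability_setT mule1.
  rewrite -ge0_integralD//; last 3 first.
  - by move=> x _; rewrite lee_fin ltW.
  - by move=> x _; apply: mule_ge0; rewrite lee_fin;
      [rewrite divr_ge0// ltW|exact: Orlicz_ge0].
  - exact: measurable_funeM.
  apply: ge0_le_integral_sup => x _; first by rewrite lee_fin.
  rewrite -EFinM -EFinD lee_fin.
  have PV0 : (0 <= a / Phi a * Phi (V x))%R by rewrite mulr_ge0 ?(Orlicz_ge0 hPhi)// divr_ge0// ltW.
  have [Va|Va] := leP `|V x|%R a; first by rewrite ler_wpDr.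
  have V0 : (0 < `|V x|)%R by exact: lt_trans Va.
  suff : (`|V x| <= a / Phi a * Phi (V x))%R by move=> h; rewrite ler_wpDl// ltW.
  have l1 : (a / `|V x| <= 1)%R by rewrite ler_pdivrMr// mul1r ltW.
  have := Orlicz_star hPhi `|V x|%R (divr_ge0 (ltW a0) (ltW V0)) l1.
  rewrite divfK ?gt_eqF// (Orlicz_norm hPhi) => h.
  rewrite mulrAC ler_pdivlMr// mulrC -ler_pdivlMr//.
  by apply: le_trans h _; rewrite mulrAC.
case: (\int[P]_x (Phi (V x))%:E) IPhi0 => [r| |]// r0.
- rewrite -EFinM -EFinD !lee_fin => h.
  have : (a <= a * (r / Phi a))%R by rewrite mulrCA mulrA; lra.
  by rewrite -[leLHS]mulr1 ler_pM2l// ler_pdivlMr// mul1r.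
- by rewrite leey.
Qed.

(** If the mean [e] is finite and positive, [x <= 2 * c * (e / 2)]; the growth bound extracts
    [2 * c], and [Orlicz_half_mean_le] handles [e / 2]. Quantifying over real [m > 0] also covers
    the mean 0, where [x] is forced to be 0. *)
Lemma Orlicz_ext_le_of_mean (c : R) (x : \bar R) : (0 <= c)%R -> 0 <= x ->
  (forall m : R, (0 < m)%R -> \int[P]_t (`|V t|%R)%:E <= m%:E -> x <= (c * m)%:E) ->
  Orlicz_ext Phi x <= (1 + K * expR (2 * c))%:E * \int[P]_t (Phi (V t))%:E.
Proof.
move=> c0 x0 H; set I := \int[P]_t (Phi (V t))%:E.
have Ke0 : (0 <= K * expR (2 * c))%R by rewrite mulr_ge0 ?expR_ge0// ltW.
have CI : I <= (1 + K * expR (2 * c))%:E * I.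
  by rewrite -[leLHS]mul1e lee_wpmul2r// lee_fin lerDl.
have e0 : 0 <= \int[P]_t (`|V t|%R)%:E.
  by apply: integral_ge0 => t _; rewrite lee_fin.
move: (@Orlicz_half_mean_le); case: (\int[P]_t (`|V t|%R)%:E) e0 H => [e| |]// e0 H half.
- have [e_gt0|e_le0] := ltP 0%R e.
    have xe : x <= (c * e)%:E by exact: H.
    case: x x0 xe {H} => [x| |]// x0 xe /=.
    apply: (@le_trans _ _ (K * expR (2 * c) * Phi (e / 2))%:E).
      rewrite lee_fin; apply: le_trans (PhiK _ _); last 2 first.
      - by rewrite mulr_ge0.
      - by rewrite divr_ge0// ltW.
      apply: Orlicz_homo => //.
      have -> : (2 * c * (e / 2) = c * e)%R by field.
      by rewrite -lee_fin.
    have h : (Phi (e / 2))%:E <= I.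
      by apply: half; rewrite ?divr_gt0// lee_fin; lra.
    rewrite EFinM; apply: (@le_trans _ _ ((K * expR (2 * c))%:E * I)).
      by apply: lee_wpmul2l; rewrite ?lee_fin.
    by rewrite lee_wpmul2r// lee_fin lerDr.
  have x_le0 : x <= 0.
    apply/lee_addgt0Pr => y y0; rewrite add0e.
    apply: le_trans (H (y / (c + 1))%R _ _) _.
    - by rewrite divr_gt0// ltr_wpDl.
    - by rewrite lee_fin (le_trans e_le0)// divr_ge0 ?ltW// ltr_wpDl.
    - rewrite lee_fin mulrCA ler_piMr ?(ltW y0)// ler_pdivrMr ?ltr_wpDl// mul1r.
      by rewrite lerDl.
  have -> : x = 0 by apply/eqP; rewrite eq_le x_le0.
  by rewrite /= Orlicz0// mule_ge0// lee_fin addr_ge0.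
(* When the mean is infinite, the integral dominates every value of [Phi], hence their supremum,
   which is the extension at infinity. *)
- apply: le_trans CI.
  have all r : (Phi r)%:E <= I.
    have [->|r0] := eqVneq r 0%R; first by rewrite Orlicz0.
    rewrite -(Orlicz_norm hPhi); apply: half; first by rewrite normr_gt0.
    by rewrite leey.
  have sup : ereal_sup (range (EFin \o Phi)) <= I.
    by apply/ereal_supP => _ [r _ <-]; exact: all.
  by case: x x0 {H} => [r| |]//= _; exact: all.
Qed.

End Orlicz_limits.

(** Specialising the rearrangement inequalities to the absolute value turns them into L_1 bounds on
    the large part of the disjoint sum. *)
Lemma Orlicz_normr (R : realType) : Orlicz_function (Num.norm : R -> R).
Proof.
split => [t|t x y _ _|t|]; [exact: normrN| |exact: normr_ge0|exact: normr0].
rewrite !convRE /unstable.onem; apply: le_trans (ler_normD _ _) _.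
have t0 : 0 <= t%:num :> R by [].
have t1 : 0 <= 1 - t%:num :> R by rewrite subr_ge0.
by rewrite !normrM (ger0_norm t0) (ger0_norm t1).
Qed.

(** * Almost everywhere comparison and L_2 norms *)

Section almost_everywhere.
Context d (T : measurableType d) (R : realType).
Variable mu : {measure set T -> \bar R}.
Variables (Q : T -> Prop) (g h : T -> \bar R).
Hypothesis aeQ : {ae mu, forall t, Q t}.
Hypotheses (mg : measurable_fun setT g) (mh : measurable_fun setT h).
Hypotheses (g0 : forall t, (0 <= g t)%E) (h0 : forall t, (0 <= h t)%E).

Lemma ae_le_integral_on : (forall t, Q t -> (g t <= h t)%E) ->
  (\int[mu]_t g t <= \int[mu]_t h t)%E.
Proof.
move=> gh; apply: ae_ge0_le_integral => //.
by apply: filterS aeQ => t Qt _; exact: gh.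
Qed.

Lemma ae_eq_integral_on : (forall t, Q t -> g t = h t) ->
  (\int[mu]_t g t = \int[mu]_t h t)%E.
Proof.
move=> gh; apply: ge0_ae_eq_integral => //.
by apply: filterS aeQ => t Qt _; exact: gh.
Qed.

End almost_everywhere.

Lemma ae_forall_ord d (T : measurableType d) (R : realType)
    (mu : {measure set T -> \bar R}) n (Q : 'I_n -> T -> Prop) :
  (forall k, {ae mu, forall t, Q k t}) -> {ae mu, forall t, forall k, Q k t}.
Proof.
move=> aeQ.
have : {ae mu, forall t, forall k, k \in index_enum 'I_n -> Q k t}.
  elim: (index_enum 'I_n) => [|k s IH]; first by apply: aeW => t k; rewrite in_nil.
  apply: filterS2 (aeQ k) IH => t Qk IH j; rewrite in_cons => /predU1P[->//|].
  exact: IH.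
by apply: filterS => t H k; apply: H; exact: mem_index_enum.
Qed.

Section Lnorm2.
Context d (T : measurableType d) (R : realType).
Variable mu : {measure set T -> \bar R}.
Local Open Scope ereal_scope.

Lemma Lnorm2_sqr (h : T -> R) :
  'N[mu]_2%:E[EFin \o h] `^ 2 = \int[mu]_t ((h t) ^+ 2)%:E.
Proof.
rewrite powR_Lnorm//; apply: eq_integral => t _ /=.
by rewrite ?poweR_EFin powR_mulrn// real_normK// num_real.
Qed.

Lemma Lnorm2_leP (h : T -> R) (M : R) : (0 <= M)%R ->
  'N[mu]_2%:E[EFin \o h] <= M%:E <-> \int[mu]_t ((h t) ^+ 2)%:E <= (M ^+ 2)%:E.
Proof.
move=> M0; rewrite -Lnorm2_sqr; set N := 'N[mu]_2%:E[EFin \o h].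
have N0 : 0 <= N by exact: Lnorm_ge0.
have M2 : (M ^+ 2)%:E = M%:E `^ 2 by rewrite poweR_EFin powR_mulrn.
rewrite M2; split => NM.
  by apply: gt0_ler_poweR => //; rewrite in_itv/= leey andbT ?lee_fin.
have K (x : \bar R) : 0 <= x -> x = (x `^ 2) `^ 2^-1.
  by move=> x0; rewrite -poweRrM divff// poweRe1.
rewrite (K N)// (K M%:E)//.
by apply: gt0_ler_poweR => //; rewrite in_itv; apply/andP; split;
  [exact: poweR_ge0|exact: leey|exact: poweR_ge0|exact: leey].
Qed.

Lemma measurable_norm_sqr (g h : T -> R) (A B : R) :
  measurable_fun setT g -> measurable_fun setT h ->
  measurable_fun setT (fun t => (A * `|g t| + B * (h t) ^+ 2)%:E).
Proof.
move=> mg mh; apply/measurable_EFinP.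
apply: measurable_funD; apply: measurable_funM => //.
  exact: (measurableT_comp (@normr_measurable R setT) mg).
exact: measurable_funX.
Qed.

(** Such combinations are the majorants through which a decomposition [F = g + h] controls both the
    tail of [F] and its truncated second moment. *)
Lemma integral_norm_sqr_le (g h : T -> R) (A B M N : R) :
  measurable_fun setT g -> measurable_fun setT h -> (0 <= A)%R -> (0 <= B)%R ->
  \int[mu]_t (`|g t|%R)%:E <= M%:E -> \int[mu]_t ((h t) ^+ 2)%:E <= N%:E ->
  \int[mu]_t (A * `|g t| + B * (h t) ^+ 2)%:E <= (A * M + B * N)%:E.
Proof.
move=> mg mh A0 B0 gM hN.
have mgE : measurable_fun setT (fun t => (`|g t|%R)%:E).
  apply/measurable_EFinP.
  exact: (measurableT_comp (@normr_measurable R setT) mg).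
have mhE : measurable_fun setT (fun t => ((h t) ^+ 2)%:E).
  by apply/measurable_EFinP; exact: measurable_funX.
have h20 t : 0 <= ((h t) ^+ 2)%:E by rewrite lee_fin sqr_ge0.
have -> : \int[mu]_t (A * `|g t| + B * (h t) ^+ 2)%:E =
    \int[mu]_t (A%:E * (`|g t|%R)%:E + B%:E * ((h t) ^+ 2)%:E).
  by apply: eq_integral => t _; rewrite EFinD !EFinM.
rewrite ge0_integralD//; last 4 first.
- by move=> t _; rewrite mule_ge0.
- exact: measurable_funeM.
- by move=> t _; rewrite mule_ge0.
- exact: measurable_funeM.
rewrite !ge0_integralZl//.
by rewrite EFinD; apply: leeD; rewrite EFinM; apply: lee_wpmul2l; rewrite ?lee_fin.
Qed.

End Lnorm2.

(** * Bounds for sums in terms of the disjoint sum *)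

Section disjoint_independent_sums.
Context (R : realType) (n : nat).
Variable f : 'I_n -> {RV (@unit_prob R) >-> measurableTypeR R}.
Hypothesis indepf : independent_RVs f.
Local Open Scope ereal_scope.

Let P : probability (lebesgueType R) R := unit_prob.
Let F : R -> R := disjoint_sum (fun k => f k : R -> R).
Let S (t : lebesgueType R) : R := \sum_k f k t.

Let mf k : measurable_fun setT (f k).
Proof. exact: measurable_funPT. Qed.

Let mS : measurable_fun setT S.
Proof. by apply: measurable_sum => k; exact: (mf k). Qed.

Lemma norm_L1_disjoint_sum : norm_L1 F = \sum_k \int[P]_t (`|f k t|%R)%:E.
Proof.
rewrite /norm_L1 Lnorm1 -(ge0_integral_disjoint_sum mf (@normr_measurable R setT))//.
by rewrite normr0.
Qed.

Lemma norm_L1_L2_ge0 : 0 <= norm_L1_L2 F.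
Proof.
apply/ereal_infP => _ [g [h [_ _ _ ->]]].
by rewrite adde_ge0// Lnorm_ge0.
Qed.

Section with_Phi.
Variables (Phi : R -> R) (K D : R).
Hypothesis hPhi : Orlicz_function Phi.
Hypothesis D0 : (0 <= D)%R.
Hypothesis PhiD : (forall t, Phi (2 * t) <= D * Phi t)%R.
Hypothesis K0 : (0 < K)%R.
Hypothesis PhiK : (forall t A, 0 <= t -> 0 <= A -> Phi (t * A) <= K * expR t * Phi A)%R.

Let J := \int[P]_t Orlicz_ext Phi (rearrangement F t).
Let c1 : R := (D * (K * D * 2 * expR 1))%R.
Let c2 : R := (D * (K * expR 1 * expR (expR 1)))%R.

(** Shared by both cases: [Q k] will be a scaled first moment or a scaled second moment of the
    truncated variable. The bound 1 on their sum explains the factor [expR 1] in [c1]. *)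
Lemma integral_Orlicz_le_threshold (a : R) (Q : 'I_n -> \bar R) : (0 < a)%R ->
  (forall k, 0 <= Q k) -> \sum_k Q k <= 1 ->
  (forall k (s : bool),
    \int[P]_x (expR ((-1) ^+ s * (below a (f k x) / (2 * a))))%:E <= 1 + Q k) ->
  half_line [set t | (a < `|F t|)%R] <= 1 ->
  \int[P]_t (Phi (S t))%:E <= c1%:E * (Phi a)%:E + c2%:E * J.
Proof.
move=> a0 Q0 Q1 Qexp d1.
have Qfin k : Q k \is a fin_num.
  rewrite ge0_fin_numE//; apply: le_lt_trans (ltry 1); apply: le_trans Q1.
  by rewrite (bigD1 k)//= leeDl// sume_ge0.
pose q k := fine (Q k).
have qE k : Q k = (q k)%:E by rewrite fineK.
have sumq : (\sum_k q k <= 1)%R.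
  by rewrite -lee_fin -sumEFin; under eq_bigr do rewrite -qE.
have q0 k : (0 <= q k)%R by rewrite fine_ge0.
have e1 k : \int[P]_x (expR (below a (f k x) / (2 * a)))%:E <= (1 + q k)%:E.
  rewrite EFinD -qE; apply: le_trans (Qexp k false).
  by under [leRHS]eq_integral do rewrite expr0 mul1r.
have e2 k : \int[P]_x (expR (- (below a (f k x) / (2 * a))))%:E <= (1 + q k)%:E.
  rewrite EFinD -qE; apply: le_trans (Qexp k true).
  by under [leRHS]eq_integral do rewrite expr1 mulN1r.
have dsum : \sum_k P [set x | (a < `|f k x|)%R] <= 1.
  by rewrite -half_line_tail// ltW.
apply: le_trans (integral_Orlicz_sum_le indepf hPhi D0 PhiD K0 PhiK a0 q0 e1 e2 dsum) _.
apply: leeD.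
  apply: lee_wpmul2r; first by rewrite lee_fin Orlicz_ge0.
  rewrite lee_fin /c1 ler_wpM2l// ler_wpM2l ?ler_expR//.
  by rewrite !mulr_ge0// ltW.
apply: lee_wpmul2l.
  by rewrite lee_fin /c2 !mulr_ge0 ?expR_ge0// ltW.
by apply: sum_above_le_integral_rearrangement => //; exact: ltW.
Qed.

(** The norm is the sum of the means of [|f k|], so one division by [a] bounds by 1 both the tail,
    through Markov's inequality, and the sum of the [Q k]. *)
Lemma integral_Orlicz_le_L1 (a : R) : (0 < a)%R -> norm_L1 F < a%:E ->
  \int[P]_t (Phi (S t))%:E <= c1%:E * (Phi a)%:E + c2%:E * J.
Proof.
move=> a0; rewrite norm_L1_disjoint_sum => /ltW Fa.
have scale (x : 'I_n -> \bar R) : (forall k, 0 <= x k) ->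
    (forall k, a%:E * x k <= \int[P]_t (`|f k t|%R)%:E) -> \sum_k x k <= 1.
  move=> x0 xa; rewrite -(@lee_pmul2l _ a%:E) ?mule1//.
  rewrite ge0_sume_distrr//; apply: le_trans Fa.
  by apply: lee_sum => k _; exact: xa.
apply: (integral_Orlicz_le_threshold (a := a)
    (Q := fun k => \int[P]_x (`|below a (f k x)| / a)%:E)) => //.
- by move=> k; apply: integral_ge0 => t _; rewrite lee_fin divr_ge0// ltW.
- apply: scale => k.
    by apply: integral_ge0 => t _; rewrite lee_fin divr_ge0// ltW.
  exact: integral_norm_below_scale_le.
- by move=> k s; exact: integral_exp_below_le.
- rewrite half_line_tail; last exact: ltW.
  apply: (scale (fun k => P [set t | (a < `|f k t|)%R])) => // k.
  exact: (markov_abs P a0 (mf k)).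
Qed.

Lemma integral_Orlicz_le_L1_L2 (M : R) : (forall k, symmetric_RV (f k)) ->
  (0 < M)%R -> norm_L1_L2 F < M%:E ->
  \int[P]_t (Phi (S t))%:E <= c1%:E * (Phi (4 * M))%:E + c2%:E * J.
Proof.
move=> symf M0 /ereal_inf_ltP[_ [g [h [gL hL Fgh ->]]] ghM].
set a := (4 * M)%R; have a0 : (0 < a)%R by rewrite mulr_gt0.
have mF : measurable_fun setT (F : lebesgueType R -> measurableTypeR R).
  exact: measurable_disjoint_sum.
have mg : measurable_fun setT g by move: gL; rewrite inE => /andP[/[!inE]].
have mh : measurable_fun setT h by move: hL; rewrite inE => /andP[/[!inE]].
have gM : \int[half_line]_t (`|g t|%R)%:E <= M%:E.
  by apply: le_trans (ltW ghM); rewrite Lnorm1 leeDl// Lnorm_ge0.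
have hM : \int[half_line]_t ((h t) ^+ 2)%:E <= (M ^+ 2)%:E.
  apply/Lnorm2_leP; first exact: ltW.
  by apply: le_trans (ltW ghM); rewrite leeDr// Lnorm_ge0.
have comb (A B : R) : (0 <= A)%R -> (0 <= B)%R ->
    \int[half_line]_t (A * `|g t| + B * (h t) ^+ 2)%:E <= (A * M + B * M ^+ 2)%:E.
  by move=> A0 B0; exact: (integral_norm_sqr_le mg mh A0 B0 gM hM).
have mtail : measurable [set t : lebesgueType R | (a < `|F t|)%R].
  exact: (measurable_norm_gt a mF).
have mcomb (A B : R) :
    measurable_fun setT (fun t => (A * `|g t| + B * (h t) ^+ 2)%:E).
  exact: (measurable_norm_sqr A B mg mh).
have comb0 (A B : R) t : (0 <= A)%R -> (0 <= B)%R ->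
    0 <= (A * `|g t| + B * (h t) ^+ 2)%:E.
  by move=> A0 B0; rewrite lee_fin addr_ge0// mulr_ge0// sqr_ge0.
(* Where [|F| > 4 * M], one of [g] and [h] has modulus at least [2 * M]. The two contributions are
   at most 1/2 and 1/4. *)
have d1 : half_line [set t : lebesgueType R | (a < `|F t|)%R] <= 1.
  rewrite -(integral_natr_bool mtail).
  have c20 : (0 <= (2 * M)^-1)%R by rewrite invr_ge0 mulr_ge0// ltW.
  have c40 : (0 <= (4 * M ^+ 2)^-1)%R by rewrite invr_ge0 mulr_ge0// sqr_ge0.
  apply: le_trans (le_trans (comb _ _ c20 c40) _); last first.
    rewrite lee_fin; have -> : ((2 * M)^-1 * M + (4 * M ^+ 2)^-1 * M ^+ 2 = 3 / 4)%R.
      by field; rewrite gt_eqF.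
    lra.
  apply: (ae_le_integral_on Fgh).
  - exact/measurable_EFinP/(measurable_natr_bool mtail).
  - exact: mcomb.
  - by move=> t; rewrite lee_fin.
  - by move=> t; exact: comb0.
  move=> t FE; rewrite lee_fin.
  have gt0 : (0 <= (2 * M)^-1 * `|g t|)%R by rewrite mulr_ge0.
  have ht0 : (0 <= (4 * M ^+ 2)^-1 * h t ^+ 2)%R by rewrite mulr_ge0// sqr_ge0.
  case: ltP => [aF|_]; last by rewrite addr_ge0.
  have [gl|gs] := ltP (2 * M)%R `|g t|%R.
    rewrite ler_wpDr// mulrC -ler_pdivrMr ?invr_gt0 ?mulr_gt0// mul1r invrK.
    exact: ltW.
  rewrite ler_wpDl//.
  have hl : (2 * M <= `|h t|)%R.
    by move: aF; rewrite FE /a; have := ler_normD (g t) (h t); lra.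
  rewrite mulrC ler_pdivlMr ?mul1r; last by rewrite mulr_gt0// exprn_gt0.
  have -> : (4 * M ^+ 2 = (2 * M) ^+ 2)%R by ring.
  by rewrite -(real_normK (num_real (h t))) lerXn2r ?nnegrE// mulr_ge0// ltW.
pose G (r : measurableTypeR R) : R := ((below a r) ^+ 2)%R.
have mG : measurable_fun setT G.
  by apply: measurable_funX; exact: measurable_below.
have G0 r : (0 <= G r)%R by exact: sqr_ge0.
(* Put z = |F| <= a, x = |g|, y = |h|. From z <= x + y follows z^2 <= a x + z y <= a x + (z^2 +
   y^2)/2, hence z^2 <= 2 a x + y^2. With a = 4 M this integrates to 8 M^2 + M^2. *)
have sq : \sum_k \int[P]_t ((below a (f k t)) ^+ 2)%:E <= (9 * M ^+ 2)%:E.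
  rewrite -(ge0_integral_disjoint_sum mf mG)//; last first.
    by rewrite /G /below mul0r expr0n.
  have a20 : (0 <= 2 * a)%R by rewrite mulr_ge0// ltW.
  apply: le_trans (le_trans (comb _ _ a20 ler01) _); last first.
    by rewrite lee_fin mul1r /a; lra.
  apply: (ae_le_integral_on Fgh).
  - by apply/measurable_EFinP; exact: (measurableT_comp mG mF).
  - exact: mcomb.
  - by move=> t; rewrite lee_fin.
  - by move=> t; exact: comb0.
  move=> t FE; rewrite lee_fin mul1r /G /below.
  case: (leP `|disjoint_sum _ t|%R a) => [|_]; last first.
    by rewrite mulr0 expr0n/= addr_ge0 ?sqr_ge0// mulr_ge0.
  rewrite mulr1 (FE : disjoint_sum _ t = _) => ghA.
  have h2 := real_normK (num_real (h t)).
  have F2 := real_normK (num_real (g t + h t)%R).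
  have tri := ler_normD (g t) (h t).
  rewrite -F2 -h2.
  move: (normr_ge0 (g t)) (normr_ge0 (h t)) (normr_ge0 (g t + h t)%R) ghA tri.
  move: `|g t|%R `|h t|%R `|(g t + h t)%R|%R => x y z x0 y0 z0 za zxy.
  have : (z * z <= z * (x + y))%R by rewrite ler_wpM2l.
  have : (0 <= (z - y) ^+ 2)%R by exact: sqr_ge0.
  have : (z * x <= a * x)%R by rewrite ler_wpM2r.
  rewrite !expr2; nra.
apply: (integral_Orlicz_le_threshold (a := a)
    (Q := fun k => \int[P]_x ((below a (f k x)) ^+ 2 / (2 * a ^+ 2))%:E)) => //.
- move=> k; apply: integral_ge0 => t _.
  by rewrite lee_fin divr_ge0 ?sqr_ge0// mulr_ge0// sqr_ge0.
- under eq_bigr do rewrite integral_sq_below_scale//.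
  rewrite -ge0_sume_distrr; last first.
    by move=> k _; apply: integral_ge0 => t _; rewrite lee_fin sqr_ge0.
  apply: (@le_trans _ _ (((2 * a ^+ 2)^-1)%:E * (9 * M ^+ 2)%:E)).
    by apply: lee_wpmul2l => //; rewrite lee_fin invr_ge0 mulr_ge0// sqr_ge0.
  rewrite -EFinM lee_fin.
  have -> : ((2 * a ^+ 2)^-1 * (9 * M ^+ 2) = 9 / 32)%R.
    by rewrite /a; field; rewrite gt_eqF.
  lra.
- by move=> k s; exact: integral_exp_below_sym_le.
Qed.

End with_Phi.

Section lower_bounds.
Variable Phi : R -> R.
Hypothesis hPhi : Orlicz_function Phi.

Let J := \int[P]_t Orlicz_ext Phi (rearrangement F t).

Let tail_le (u : R) : (0 <= u)%R ->
  mine 1 (half_line [set t | (u < `|F t|)%R]) <=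
  2%:E * P [set t | exists k, (u < `|f k t|)%R].
Proof. by move=> u0; rewrite half_line_tail//; exact: tail_max_ge. Qed.

Let measurable_S_gt (u : R) : measurable [set t | (u < `|S t|)%R].
Proof. exact: measurable_norm_gt. Qed.

Section nonnegative.
Hypothesis f0 : forall k, {ae unit_prob, forall t, (0 <= f k t)%R}.

Let all_f0 : {ae unit_prob, forall t, forall k, (0 <= f k t)%R}.
Proof. exact: ae_forall_ord. Qed.

Lemma integral_rearrangement_le_nonneg : J <= 2%:E * \int[P]_t (Phi (S t))%:E.
Proof.
apply: (integral_rearrangement_le_tail hPhi) => // u u0.
apply: le_trans (tail_le u0) _; apply: lee_wpmul2l => //.
have maxE : [set t | exists k, (u < `|f k t|)%R] =
    [set t | `[< exists k, (u < `|f k t|)%R >]].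
  by apply/seteqP; split => t /asboolP.
have mexb := measurable_max_abs_gt f u.
rewrite maxE in mexb *.
rewrite -(integral_natr_bool mexb) -(integral_natr_bool (measurable_S_gt u)).
apply: (ae_le_integral_on all_f0).
- exact/measurable_EFinP/(measurable_natr_bool mexb).
- exact/measurable_EFinP/(measurable_natr_bool (measurable_S_gt u)).
- by move=> t; rewrite lee_fin.
- by move=> t; rewrite lee_fin.
move=> t ft0; rewrite lee_fin ler_nat.
case: asboolP => [[k uk]|//]; rewrite lt0b.
apply: (lt_le_trans uk); rewrite (ger0_norm (ft0 k)).
by rewrite ger0_norm ?sumr_ge0// /S (bigD1 k)//= lerDl sumr_ge0.
Qed.

Lemma norm_L1_nonneg : norm_L1 F = \int[P]_t (`|S t|%R)%:E.
Proof.
have mfn k : measurable_fun setT (fun t => (`|f k t|%R)%:E).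
  apply/measurable_EFinP.
  exact: (measurableT_comp (@normr_measurable R setT) (mf k)).
have fn0 k t : setT t -> 0 <= (`|f k t|%R)%:E by move=> _; rewrite lee_fin.
rewrite norm_L1_disjoint_sum -(ge0_integral_sum P measurableT mfn fn0).
apply: (ae_eq_integral_on all_f0).
- exact: emeasurable_sum.
- apply/measurable_EFinP; exact: (measurableT_comp (@normr_measurable R setT) mS).
- by move=> t; apply: sume_ge0.
- by move=> t; rewrite lee_fin.
move=> t ft0; rewrite sumEFin; congr (_%:E).
rewrite ger0_norm ?sumr_ge0//; apply: eq_bigr => k _.
by rewrite ger0_norm.
Qed.

End nonnegative.

Section symmetric.
Hypothesis symf : forall k, symmetric_RV (f k).

(** One factor 2 comes from passing to the maximum, the other from Levy's inequality. *)
Lemma half_line_tail_le_sym (u : R) : (0 <= u)%R ->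
  mine 1 (half_line [set t | (u < `|F t|)%R]) <= 4%:E * P [set t | (u < `|S t|)%R].
Proof.
move=> u0; apply: le_trans (tail_le u0) _.
have -> : 4%:E = 2%:E * 2%:E :> \bar R by rewrite -EFinM; congr (_%:E); ring.
by rewrite -muleA; apply: lee_wpmul2l => //; exact: tail_max_le_sum.
Qed.

Lemma integral_rearrangement_le_sym : J <= 4%:E * \int[P]_t (Phi (S t))%:E.
Proof.
apply: (integral_rearrangement_le_tail hPhi) => // u u0.
exact: half_line_tail_le_sym.
Qed.

End symmetric.

End lower_bounds.

End disjoint_independent_sums.

(** * Bounding the L_1 + L_2 norm by the mean *)

Section symmetric_norm.
Context (R : realType) (n : nat).
Variable f : 'I_n -> {RV (@unit_prob R) >-> measurableTypeR R}.
Hypothesis indepf : independent_RVs f.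
Hypothesis symf : forall k, symmetric_RV (f k).
Local Open Scope ereal_scope.

Let P : probability (lebesgueType R) R := unit_prob.
Let F : R -> R := disjoint_sum (fun k => f k : R -> R).
Let S (t : lebesgueType R) : R := \sum_k f k t.

(** The constant is 4 + 8. The large part has L_1 norm at most 4 m by the rearrangement inequalities
    for the absolute value; the small part has second moment at most 2 (5 m)^2 = 50 m^2 <= (8
    m)^2. *)
Lemma norm_L1_L2_le_mean (m : R) : (0 < m)%R ->
  \int[P]_t (`|S t|%R)%:E <= m%:E -> norm_L1_L2 F <= (12 * m)%:E.
Proof.
move=> m0 Sm; set u := (5 * m)%R; have u0 : (0 < u)%R by rewrite mulr_gt0.
have mf k : measurable_fun setT (f k) by exact: measurable_funPT.
have mF : measurable_fun setT (F : lebesgueType R -> measurableTypeR R).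
  exact: measurable_disjoint_sum.
have mS : measurable_fun setT S by apply: measurable_sum => k; exact: (mf k).
(* Markov's inequality gives probability at most 1/5 at level [5 * m], so the minimum of 1 and the
   tail is at most 4/5. It is therefore the tail itself. *)
have d1 : half_line [set t | (u < `|F t|)%R] <= 1.
  have := half_line_tail_le_sym indepf symf (ltW u0).
  have := le_trans (markov_abs P u0 mS) Sm.
  have pfin : P [set t | (u < `|S t|)%R] \is a fin_num.
    by rewrite fin_num_measure//; exact: measurable_norm_gt.
  rewrite -(fineK pfin) -!EFinM lee_fin.
  move: (fine _) => p up.
  have p5 : (p <= 5^-1)%R.
    rewrite -(ler_pM2l u0) (le_trans up)// /u le_eqVlt; apply/orP; left.
    by apply/eqP; field.
  rewrite ge_min => /orP[|dp]; first by rewrite lee_fin => p4; exfalso; lra.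
  by apply: le_trans dp _; rewrite lee_fin; lra.
pose g (t : lebesgueType R) : R := above u (F t).
pose h (t : lebesgueType R) : R := below u (F t).
have mg : measurable_fun setT g by exact: (measurableT_comp (measurable_above u) mF).
have mh : measurable_fun setT h by exact: (measurableT_comp (measurable_below u) mF).
have gN : 'N[half_line]_1[EFin \o g] <= (4 * m)%:E.
  rewrite Lnorm1.
  pose G (r : measurableTypeR R) : R := `|above u r|%R.
  have mG : measurable_fun setT G.
    exact: (measurableT_comp (@normr_measurable R setT) (measurable_above u)).
  have G0 r : (0 <= G r)%R by exact: normr_ge0.
  have Gz : G 0%R = 0%R by rewrite /G /above mul0r normr0.
  rewrite [leLHS](ge0_integral_disjoint_sum mf mG G0 Gz).
  have := sum_above_le_integral_rearrangement (Orlicz_normr R) (ltW u0) d1.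
  have := integral_rearrangement_le_sym indepf (Orlicz_normr R) symf.
  move=> h1 h2; apply: le_trans (le_trans h2 (le_trans h1 _)); last first.
    by rewrite EFinM; apply: lee_wpmul2l.
  apply: lee_sum => k _; apply: ge0_le_integral_sup => t _; first by rewrite lee_fin.
  by rewrite -EFinM lee_fin /G /above normrM normr_nat.
have hN : 'N[half_line]_2%:E[EFin \o h] <= (8 * m)%:E.
  apply/Lnorm2_leP; first by rewrite mulr_ge0// ltW.
  pose G (r : measurableTypeR R) : R := (below u r ^+ 2)%R.
  have mG : measurable_fun setT G by apply: measurable_funX; exact: measurable_below.
  have G0 r : (0 <= G r)%R by exact: sqr_ge0.
  have Gz : G 0%R = 0%R by rewrite /G /below mul0r expr0n.
  rewrite [leLHS](ge0_integral_disjoint_sum mf mG G0 Gz).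
  apply: le_trans (second_moment_below indepf symf m0 Sm) _.
  by rewrite lee_fin; nra.
apply: ge_ereal_inf; exists ('N[half_line]_1[EFin \o g] + 'N[half_line]_2%:E[EFin \o h]).
  exists g, h; split => //.
  - rewrite inE; apply/andP; split; rewrite inE//.
    exact: le_lt_trans gN (ltry _).
  - rewrite inE; apply/andP; split; rewrite inE//.
    exact: le_lt_trans hN (ltry _).
  - by apply: aeW => t; rewrite /g /h addrC belowDabove.
apply: le_trans (leeD gN hN) _.
by rewrite -EFinD lee_fin -mulrDl; lra.
Qed.

End symmetric_norm.

(** * Assembly of the two equivalences *)

Lemma equiv_upto_sum (R : realType) (C a b p q : R) (E J N : \bar R) :
  (0 <= E)%E -> (0 <= J)%E -> (0 <= N)%E ->
  0 <= a -> 0 <= b -> 0 <= p -> 0 <= q -> a + b <= C -> p + q <= C ->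
  (E <= a%:E * N + b%:E * J)%E -> (J <= p%:E * E)%E -> (N <= q%:E * E)%E ->
  equiv_upto C E (J + N)%E.
Proof.
move=> E0 J0 N0 a0 b0 p0 q0 abC pqC up lowJ lowN; split.
  apply: le_trans up _; rewrite ge0_muleDr// addeC; apply: leeD.
    by apply: lee_wpmul2r => //; rewrite lee_fin; lra.
  by apply: lee_wpmul2r => //; rewrite lee_fin; lra.
apply: le_trans (leeD lowJ lowN) _; rewrite -ge0_muleDl ?lee_fin// -EFinD.
by apply: lee_wpmul2r => //; rewrite lee_fin.
Qed.

Theorem theorem1p3 (R : realType) (Phi : R -> R)
    (hPhi : Orlicz_function Phi) (hD2 : Delta2 Phi) :
  exists2 C : R, 0 < C &
    forall (n : nat)
      (f : 'I_n -> {RV (@unit_prob R) >-> measurableTypeR R}),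
      (forall k, Orlicz_space Phi (f k)) ->
      independent_RVs f ->
      let F := disjoint_sum (fun k => f k : R -> R) in
      ((forall k, {ae @unit_prob R, forall t, 0 <= f k t}) ->
        equiv_upto C
          'E_(@unit_prob R)[fun t : lebesgueType R => Phi (\sum_(k < n) f k t)]
          (\int[@unit_prob R]_t Orlicz_ext Phi (rearrangement F t)
            + Orlicz_ext Phi (norm_L1 F))%E)
      /\
      ((forall k, symmetric_RV (f k)) ->
        equiv_upto C
          'E_(@unit_prob R)[fun t : lebesgueType R => Phi (\sum_(k < n) f k t)]
          (\int[@unit_prob R]_t Orlicz_ext Phi (rearrangement F t)
            + Orlicz_ext Phi (norm_L1_L2 F))%E).
Proof.
have [Phi0|Phi_neq0] := pselect (forall t, Phi t = 0).
  exists 1 => // n f _ _ F.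
  have ext0 (x : \bar R) : Orlicz_ext Phi x = 0%E.
    have sup0 : ereal_sup (range (EFin \o Phi)) = 0%E.
      rewrite (_ : range _ = [set 0%E]) ?ereal_sup1//.
      by apply/seteqP; split => [_ [t _ <-]|_ ->]; [|exists 0]; rewrite //= Phi0.
    by case: x => //= r; rewrite Phi0.
  have J0 : (\int[@unit_prob R]_t Orlicz_ext Phi (rearrangement F t) = 0)%E.
    by apply: integral0_eq => t _; rewrite ext0.
  have E0 : ('E_(@unit_prob R)[fun t : lebesgueType R =>
      (Phi (\sum_(k < n) f k t))%R] = 0)%E.
    by rewrite unlock; apply: integral0_eq => t _; rewrite Phi0.
  by split => _; rewrite /equiv_upto E0 J0 ext0 adde0 mule0.
have [D0 hD0] := hD2.
(* The maximum with 1 makes [D] visibly positive. Evenness and [Phi 0 = 0] then extend the doubling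
   inequality from [t > 0] to all [t]. *)
pose D := Num.max D0 1.
have D1 : 1 <= D by rewrite le_max lexx orbT.
have D_ge0 : 0 <= D by lra.
have PhiD t : Phi (2 * t) <= D * Phi t.
  rewrite -(Orlicz_norm hPhi t) -(Orlicz_norm hPhi (2 * t)) normrM.
  rewrite (ger0_norm (x := 2))//.
  have := normr_ge0 t; rewrite le_eqVlt => /predU1P[<-|t0].
    by rewrite mulr0 (Orlicz0 hPhi) mulr0.
  apply: le_trans (hD0 _ t0) _; rewrite ler_wpM2r ?(Orlicz_ge0 hPhi)//.
  by rewrite le_max lexx.
have [K K0 PhiK] := Orlicz_exp_growth hPhi D_ge0 PhiD.
pose c1 := D * (K * D * 2 * expR 1).
pose c2 := D * (K * expR 1 * expR (expR 1)).
pose e (c : R) := 1 + K * expR (2 * c).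
have c10 : 0 < c1 by rewrite !mulr_gt0 ?expR_gt0//; lra.
have c20 : 0 < c2 by rewrite !mulr_gt0 ?expR_gt0//; lra.
have e0 c : 0 < e c by rewrite addr_gt0// mulr_gt0// expR_gt0.
have c1D : 0 < c1 * D by rewrite mulr_gt0//; lra.
have c1DDD : 0 < c1 * D ^+ 2 * D by rewrite !mulr_gt0 ?exprn_gt0//; lra.
(* In the symmetric case [D ^+ 2] pays for [Phi (4 * M)]; in both cases a last [D] pays for the
   passage to the norm. The 4 covers the rearrangement constants 2 and 4, and [e 1], [e 12] come
   from bounding the norms by 1 and 12 times the mean. *)
pose C := c1 * D + c1 * D ^+ 2 * D + c2 + 4 + e 1 + e 12.
have C0 : 0 < C by have := e0 1; have := e0 12; rewrite /C; lra.
exists C => // n f _ indepf F.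
set E := ('E_(@unit_prob R)[_])%E; set J := (\int[_]_t _)%E.
have EE : E = (\int[@unit_prob R]_t (Phi (\sum_(k < n) f k t)%R)%:E)%E.
  by rewrite /E unlock.
have E_ge0 : (0 <= E)%E.
  by rewrite EE; apply: integral_ge0 => t _; rewrite lee_fin (Orlicz_ge0 hPhi).
have J_ge0 : (0 <= J)%E.
  by apply: integral_ge0 => t _; exact: Orlicz_ext_ge0.
have mS : measurable_fun setT (fun t : lebesgueType R => \sum_(k < n) f k t).
  by apply: measurable_sum => k; exact: (@measurable_funPT _ _ _ _ (f k)).
split => hf.
- have N0 : (0 <= Orlicz_ext Phi (norm_L1 F))%E by exact: Orlicz_ext_ge0.
  apply: (@equiv_upto_sum _ C (c1 * D) c2 2 (e 1)) => //; rewrite ?(ltW c1D) ?(ltW c20) ?(ltW (e0 1))//.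
  + by have := e0 12; have := e0 1; rewrite /C; lra.
  + by have := e0 12; rewrite /C; lra.
  + apply: le_Orlicz_ext_from_above => //; first exact: ltW.
    * exact: Lnorm_ge0.
    * by rewrite mule_ge0// lee_fin ltW.
    * move=> A A0 FA; rewrite EE.
      exact: (integral_Orlicz_le_L1 indepf hPhi D_ge0 PhiD K0 PhiK A0 FA).
  + rewrite EE; exact: (integral_rearrangement_le_nonneg indepf hPhi hf).
  + rewrite EE; apply: (Orlicz_ext_le_of_mean hPhi K0 PhiK mS) => //.
      exact: Lnorm_ge0.
    by move=> m _; rewrite mul1r (norm_L1_nonneg hf).
- have N0 : (0 <= Orlicz_ext Phi (norm_L1_L2 F))%E by exact: Orlicz_ext_ge0.
  apply: (@equiv_upto_sum _ C (c1 * D ^+ 2 * D) c2 4 (e 12)) => //; rewrite ?(ltW c1DDD) ?(ltW c20) ?(ltW (e0 12))//.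
  + by have := e0 12; have := e0 1; rewrite /C; lra.
  + by have := e0 1; rewrite /C; lra.
  + apply: le_Orlicz_ext_from_above => //.
    * by rewrite mulr_ge0 ?sqr_ge0// ltW.
    * exact: norm_L1_L2_ge0.
    * by rewrite mule_ge0// lee_fin ltW.
    * move=> M M0 FM; rewrite EE.
      apply: le_trans (integral_Orlicz_le_L1_L2 indepf hPhi D_ge0 PhiD K0 PhiK hf M0 FM) _.
      apply: leeD => //; rewrite -!EFinM lee_fin -/c1 -[leRHS]mulrA.
      rewrite ler_wpM2l ?(ltW c10)//.
      have -> : 4 * M = 2 ^+ 2 * M by ring.
      exact: (Delta2_expn D_ge0 PhiD).
  + rewrite EE; exact: (integral_rearrangement_le_sym indepf hPhi hf).
  + rewrite EE; apply: (Orlicz_ext_le_of_mean hPhi K0 PhiK mS) => //.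
      exact: norm_L1_L2_ge0.
    by move=> m m0 Sm; exact: (norm_L1_L2_le_mean indepf hf m0 Sm).
Qed.
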